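(* Every conical escape rate game has a uniform value. In particular, the matrix multiplication game associated with two nonempty compact sets of $n\times n$ matrices $\mathcal{A},\mathcal{B}$ has a uniform value in each of the following cases: (a) $\mathcal{A},\mathcal{B}\subset \mathrm{GL}_n(\mathbb{C})$; (b) there is a proper cone $C\subset\mathbb{R}^n$ such that every matrix in $\mathcal{A}\cup\mathcal{B}$ is real and preserves the interior of $C$.
   Context: A proper cone $C\subset\mathbb{R}^n$ is a convex, closed, pointed cone with nonempty interior $\mathrm{int}\,C$; $x\leq_C y$ means $y-x\in C$. The Funk hemi-metric on $\mathrm{int}\,C$ is $\mathrm{Funk}(x,y)=\log\inf\{\alpha>0\mid x\leq_C\alpha y\}$. The topology on $\mathrm{int}\,C$ is that of the symmetrized metric $\max(\mathrm{Funk}(x,y),\mathrm{Funk}(y,x))$ (it coincides with the norm topology). Conical escape rate game: $\mathcal{A},\mathcal{B}$ are nonempty compact sets, and for each $(a,b)\in\mathcal{A}\times\mathcal{B}$, $T_{ab}:\mathrm{int}\,C\to\mathrm{int}\,C$ is order preserving ($x\leq_Cy\Rightarrow T_{ab}(x)\leq_CT_{ab}(y)$) and positively homogeneous of degree 1 ($T_{ab}(\lambda x)=\lambda T_{ab}(x)$ for $\lambda>0$). Standing assumption: for all $x$ the maps $b\mapsto T_{ab}(x)$ (each $a$) and $a\mapsto T_{ab}(x)$ (each $b$) are continuous, and for every compact $K\subset\mathrm{int}\,C$ the set $\{T_{ab}(x)\mid (a,b,x)\in\mathcal{A}\times\mathcal{B}\times K\}$ is compact. From an initial state $x_0\in\mathrm{int}\,C$,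 at each turn $k\geq1$ player Min chooses $a_k\in\mathcal{A}$, then player Max, having observed $a_k$, chooses $b_k\in\mathcal{B}$, and $x_k=T_{a_kb_k}(x_{k-1})$. A strategy of Min maps each finite history (of states and actions) to an element of $\mathcal{A}$; a strategy of Max maps each finite history together with Min's next action to an element of $\mathcal{B}$. Let $J_k(\sigma,\tau)=\mathrm{Funk}(x_k,x_0)$ for the play generated by strategies $\sigma$ of Min and $\tau$ of Max. Min minimizes and Max maximizes $\limsup_kJ_k/k$. Matrix multiplication game: Min and Max alternately choose matrices $a_1\in\mathcal{A},b_1\in\mathcal{B},a_2\in\mathcal{A},\dots$, each observing all previous choices; here $J_k=\log\|a_1b_1\cdots a_kb_k\|$ for a fixed matrix norm $\|\cdot\|$ (its choice is irrelevant), and Min minimizes and Max maximizes $\limsup_kJ_k/k$ (equivalently $\limsup_k\|a_1b_1\cdots a_kb_k\|^{1/k}$). A real matrix $M$ preserves the interior of $C$ if $xM\in\mathrm{int}\,C$ for all $x\in\mathrm{int}\,C$, where elements of $\mathbb{R}^n$ are viewed as row vectors. Such a game has uniform value $v_\infty\in\mathbb{R}$ if for all $\epsilon>0$ there exist strategies $\sigma_\epsilon,\tau_\epsilon$ (of Min and Max) and $N$ such that for all $k\geq N$ and all strategies $\sigma$ of Min and $\tau$ of Max, $J_k(\sigma_\epsilon,\tau)/k\leq v_\infty+\epsilon$ and $J_k(\sigma,\tau_\epsilon)/k\geq v_\infty-\epsilon$. *)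

(* Defs.v *)
From HB Require Import structures.
From mathcomp Require Import all_boot all_order all_algebra.
From mathcomp Require Import all_classical all_reals all_analysis.
From mathcomp Require Import complex.

Set Implicit Arguments.
Unset Strict Implicit.
Unset Printing Implicit Defensive.

Import Order.TTheory GRing.Theory Num.Theory.
Import numFieldNormedType.Exports.

Local Open Scope classical_set_scope.
Local Open Scope ring_scope.
Local Open Scope complex_scope.

(* [H] is the type of histories: [h0] is the initial history and [extend h a b]
   records one more turn, in which Min played [a] and then Max played [b]. *)
Section PerfectInformationGame.
Variables (R : realType) (TA TB H : Type).
Variables (A : set TA) (B : set TB) (h0 : H) (extend : H -> TA -> TB -> H).

Definition strategyMin : set (H -> TA) :=
  [set sigma | forall h, A (sigma h)].

Definition strategyMax : set (H -> TA -> TB) :=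
  [set tau | forall h a, A a -> B (tau h a)].

Fixpoint play (sigma : H -> TA) (tau : H -> TA -> TB) (k : nat) : H :=
  if k is k'.+1 then
    let h := play sigma tau k' in
    let a := sigma h in extend h a (tau h a)
  else h0.

(* [payoff h] is the cumulated payoff J_k once the first k turns have produced
   the history [h]. *)
Definition has_uniform_value (payoff : H -> R) : Prop :=
  let J k sigma tau := payoff (play sigma tau k) in
  exists v : R, forall eps : R, 0 < eps ->
  exists (sigma_eps : H -> TA) (tau_eps : H -> TA -> TB) (N : nat),
    [/\ strategyMin sigma_eps, strategyMax tau_eps &
        forall k : nat, (N <= k)%N ->
        forall (sigma : H -> TA) (tau : H -> TA -> TB),
          strategyMin sigma -> strategyMax tau ->
          J k sigma_eps tau / k%:R <= v + eps /\
          v - eps <= J k sigma tau_eps / k%:R].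

End PerfectInformationGame.

Section ConicalEscapeRateGame.
Variables (R : realType) (n : nat).
Implicit Types (C : set 'rV[R]_n) (x y : 'rV[R]_n).

Record proper_cone C : Prop := ProperCone {
  cone_scale : forall (t : R) x, 0 <= t -> C x -> C (t *: x) ;
  cone_convex : convex_set (C : set (convex_lmodType 'rV[R]_n)) ;
  cone_closed : closed C ;
  cone_pointed : forall x, C x -> C (- x) -> x = 0 ;
  cone_interior : C° !=set0 }.

Definition cone_le C x y : Prop := C (y - x).

(* For C proper, n > 0 and x, y in the interior of C, the set below is nonempty
   and its infimum is positive, so that the conventions of [inf] and [ln]
   outside their domains play no role. *)
Definition Funk C x y : R :=
  ln (inf [set alpha : R | 0 < alpha /\ cone_le C x (alpha *: y)]).

(* On the interior of C the Funk topology is the norm topology, which is the one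
   used here; [T] is a total function, of which only the restriction to
   A * B * interior C matters. *)
Record conical_escape_rate_game (TA TB : topologicalType)
    (C : set 'rV[R]_n) (A : set TA) (B : set TB)
    (T : TA -> TB -> 'rV[R]_n -> 'rV[R]_n) : Prop := ConicalEscapeRateGame {
  game_cone : proper_cone C ;
  game_A_nonempty : A !=set0 ;
  game_A_compact : compact A ;
  game_B_nonempty : B !=set0 ;
  game_B_compact : compact B ;
  game_interior : forall a b x, A a -> B b -> C° x -> C° (T a b x) ;
  game_order_preserving : forall a b x y, A a -> B b -> C° x -> C° y ->
    cone_le C x y -> cone_le C (T a b x) (T a b y) ;
  game_homogeneous : forall a b (lambda : R) x, A a -> B b -> 0 < lambda ->
    C° x -> T a b (lambda *: x) = lambda *: T a b x ;
  game_continuous_B : forall a x, A a -> C° x ->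
    {within B, continuous (fun b => T a b x)} ;
  game_continuous_A : forall b x, B b -> C° x ->
    {within A, continuous (fun a => T a b x)} ;
  game_compact : forall K : set 'rV[R]_n, compact K -> K `<=` C° ->
    compact [set z | exists a b x, [/\ A a, B b, K x & z = T a b x]] }.

(* A history is (x_0, [:: (a_1, b_1, x_1); ...; (a_k, b_k, x_k)]). *)
Definition escape_history (TA TB : Type) : Type :=
  ('rV[R]_n * seq (TA * TB * 'rV[R]_n))%type.

Definition current_state (TA TB : Type) (h : escape_history TA TB) : 'rV[R]_n :=
  last h.1 [seq abx.2 | abx <- h.2].

Definition escape_extend (TA TB : Type)
    (T : TA -> TB -> 'rV[R]_n -> 'rV[R]_n)
    (h : escape_history TA TB) (a : TA) (b : TB) : escape_history TA TB :=
  (h.1, rcons h.2 (a, b, T a b (current_state h))).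

Definition escape_payoff (TA TB : Type) C (h : escape_history TA TB) : R :=
  Funk C (current_state h) h.1.

Definition escape_game_has_uniform_value (TA TB : Type) C
    (A : set TA) (B : set TB) (T : TA -> TB -> 'rV[R]_n -> 'rV[R]_n)
    (x0 : 'rV[R]_n) : Prop :=
  has_uniform_value A B (x0, [::]) (escape_extend T)
    (@escape_payoff TA TB C).

End ConicalEscapeRateGame.

(* The topology of MathComp-Analysis is inferred on a [numFieldType], but not
   on the bare type [R[i]]. *)
Definition complexField (R : realType) : numFieldType := R[i].

Section MatrixMultiplicationGame.
Variables (R : realType) (n : nat).
Local Notation Mn := 'M[complexField R]_n.

(* Submultiplicativity is not required. *)
Record matrix_norm (nm : Mn -> R) : Prop := MatrixNorm {
  matrix_norm_eq0 : forall M, nm M = 0 -> M = 0 ;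
  matrix_normZ : forall (z : complexField R) M,
    nm (z *: M) = ComplexField.Normc.normc z * nm M ;
  matrix_normD : forall M M', nm (M + M') <= nm M + nm M' }.

Definition preserves_interior (C : set 'rV[R]_n) (M : 'M[R]_n) : Prop :=
  forall x : 'rV[R]_n, C° x -> C° (x *m M).

(* A history is [:: (a_1, b_1); ...; (a_k, b_k)]. *)
Definition matrix_payoff (nm : Mn -> R) (h : seq (Mn * Mn)) : R :=
  ln (nm (\big[mulmx/1%:M]_(ab <- h) (ab.1 *m ab.2))).

Definition matrix_game_has_uniform_value (A B : set Mn) (nm : Mn -> R) : Prop :=
  has_uniform_value A B [::] (fun h a b => rcons h (a, b)) (matrix_payoff nm).

End MatrixMultiplicationGame.

(* Main.v *)
(* Each order preserving, positively homogeneous self-map of int C is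
   nonexpansive for the Funk hemi-metric d, which reduces everything to a game
   with nonexpansive dynamics and payoff d(x_k, x0).  Let s_k be the value of its
   k-turn version, and rho = inf_k s_k / k.  Min guarantees rho + eps by replaying
   near-optimal play of an m-turn game in blocks: the errors d(x, y) between the
   true state and a simulated state restarted at x0 do not grow.  Max guarantees
   rho - eps by playing for infinitely many horizons K at once: if K is a record
   of k |-> s_k - k (rho - eps), optimal play at horizon K gains rho - eps per turn
   up to every intermediate time, and a limit of such plays along an ultrafilter
   on the horizons gains it for ever.
   Matrices preserving int C act on int C, and GL_n acts on itself by right
   multiplication, isometrically for log ||x y^-1||; in both cases
   log ||a1 b1 ... ak bk|| differs from d(x_k, x0) by a bounded amount. *)

Require Import Defs.
From HB Require Import structures.
From mathcomp Require Import all_boot all_order all_algebra.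
From mathcomp Require Import all_classical all_reals all_analysis.
From mathcomp Require Import complex lra.

Set Implicit Arguments.
Unset Strict Implicit.
Unset Printing Implicit Defensive.

Import Order.TTheory GRing.Theory Num.Theory.
Import numFieldNormedType.Exports.

Local Open Scope classical_set_scope.
Local Open Scope ring_scope.

(** * Games with nonexpansive dynamics *)

Lemma eventually_le_mul (R : realType) (C e : R) : 0 < e ->
  exists N : nat, forall k : nat, (N <= k)%N -> C <= k%:R * e.
Proof.
move=> e0; exists (Num.truncn (`|C| / e)).+1 => k Nk.
rewrite -ler_pdivrMr//; apply: (@le_trans _ _ (`|C| / e)).
  by rewrite ler_pM2r ?invr_gt0// ler_norm.
by apply: le_trans (ltW (truncnS_gt _)) _; rewrite ler_nat.
Qed.

(** Since [d] is not symmetric, one turn from [x0] is bounded in both directions. Conical games and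
    both kinds of matrix games are instances. *)
Record hemimetric_game (R : realType) (X TA TB : Type) (D : set X)
    (d : X -> X -> R) (A : set TA) (B : set TB) (T : TA -> TB -> X -> X)
    (x0 : X) (L : R) : Prop := HemimetricGame {
  hg_x0 : D x0 ;
  hg_A : A !=set0 ;
  hg_B : B !=set0 ;
  hg_D : forall a b x, A a -> B b -> D x -> D (T a b x) ;
  hg_triangle : forall x y z, D x -> D y -> D z -> d x z <= d x y + d y z ;
  hg_nonexp : forall a b x y, A a -> B b -> D x -> D y ->
    d (T a b x) (T a b y) <= d x y ;
  hg_out : forall a b, A a -> B b -> d (T a b x0) x0 <= L ;
  hg_in : forall a b, A a -> B b -> d x0 (T a b x0) <= L ;
  (* Sequential form of the compactness of [B] and of the continuity of
     [b |-> T a b x], the only topology needed. *)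
  hg_ultra : forall (U : set_system nat) (u : nat -> TB) a x, UltraFilter U ->
    (forall k, B (u k)) -> A a -> D x ->
    exists2 b, B b & forall e, 0 < e ->
      \forall k \near U, d (T a (u k) x) (T a b x) <= e }.

(** * Finite-horizon values and the guarantees of the two players *)

Section Value.
Variables (R : realType) (X TA TB : Type) (D : set X) (d : X -> X -> R).
Variables (A : set TA) (B : set TB) (T : TA -> TB -> X -> X) (x0 : X) (L : R).
Hypothesis game : hemimetric_game D d A B T x0 L.

Let Dx0 := hg_x0 game.
Let DT := hg_D game.
Let triangle := hg_triangle game.

(** The inf-sup over actions is written as one infimum, over the levels that some action of Min
    enforces, so that a single boundedness condition arises. *)
Fixpoint value (k : nat) (x : X) : R :=
  if k is k'.+1
  then inf [set c | exists2 a, A a & forall b, B b -> value k' (T a b x) <= c]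
  else d x x0.

Definition state (s : seq (TA * TB)) : X :=
  foldl (fun x ab => T ab.1 ab.2 x) x0 s.

Lemma state_rcons s a b : state (rcons s (a, b)) = T a b (state s).
Proof. by rewrite /state foldl_rcons. Qed.

Lemma hg_step_out a b x : A a -> B b -> D x -> d (T a b x) x0 <= d x x0 + L.
Proof.
move=> Aa Bb Dx; have DTx := DT Aa Bb Dx; have DT0 := DT Aa Bb Dx0.
apply: le_trans (triangle DTx DT0 Dx0) _.
by rewrite lerD ?(hg_nonexp game) ?(hg_out game).
Qed.

Lemma hg_step_in a b x : A a -> B b -> D x -> d x0 (T a b x) <= d x0 x + L.
Proof.
move=> Aa Bb Dx; have DTx := DT Aa Bb Dx; have DT0 := DT Aa Bb Dx0.
apply: le_trans (triangle Dx0 DT0 DTx) _.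
by rewrite addrC lerD ?(hg_nonexp game) ?(hg_in game).
Qed.

(** The infimum in [value k.+1] is controlled only once [value k] is Lipschitz, so this is a
    hypothesis of the next facts until the induction in [value_lip] discharges it. *)
Let lip k := forall x y, D x -> D y -> value k x <= value k y + d x y.

Let step_bounds k x : lip k -> D x -> exists M, forall a b, A a -> B b ->
  - M <= value k (T a b x) <= M.
Proof.
move=> lipk Dx; exists (`|value k x0| + `|d x x0| + `|d x0 x| + L).
move=> a b Aa Bb.
have := lipk _ _ (DT Aa Bb Dx) Dx0; have := lipk _ _ Dx0 (DT Aa Bb Dx).
have := hg_step_out Aa Bb Dx; have := hg_step_in Aa Bb Dx.
have := ler_norm (value k x0); have := lerNnormlW (lexx `|value k x0|).
have := ler_norm (d x x0); have := ler_norm (d x0 x).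
have := normr_ge0 (d x x0); have := normr_ge0 (d x0 x).
by move=> *; apply/andP; split; lra.
Qed.

Let has_inf_step k x : lip k -> D x ->
  has_inf [set c | exists2 a, A a & forall b, B b -> value k (T a b x) <= c].
Proof.
move=> lipk Dx; have [M HM] := step_bounds lipk Dx; split.
  have [a Aa] := hg_A game; exists M, a => // b Bb.
  by have /andP[] := HM a b Aa Bb.
exists (- M) => c [a Aa Hc]; have [b Bb] := hg_B game.
by apply: le_trans (Hc b Bb); have /andP[] := HM a b Aa Bb.
Qed.

Let minstep k x e : lip k -> D x -> 0 < e ->
  exists2 a, A a & forall b, B b -> value k (T a b x) <= value k.+1 x + e.
Proof.
move=> lipk Dx e0; have [c [a Aa Hc] lec] := inf_adherent e0 (has_inf_step lipk Dx).
by exists a => // b Bb; apply: le_trans (Hc b Bb) (ltW lec).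
Qed.

Let maxstep k x a e : lip k -> D x -> A a -> 0 < e ->
  exists2 b, B b & value k.+1 x - e <= value k (T a b x).
Proof.
move=> lipk Dx Aa e0; apply: contrapT => H.
have : value k.+1 x <= value k.+1 x - e.
  apply: ge_inf; first by case: (has_inf_step lipk Dx).
  exists a => // b Bb; rewrite leNgt; apply/negP => /ltW lt_b.
  by apply: H; exists b.
by rewrite lerDl oppr_ge0 leNgt e0.
Qed.

(** At [x], Min copies a near-optimal action for [y]; nonexpansiveness keeps the successors within
    [d x y] whatever Max replies. *)
Lemma value_lip k x y : D x -> D y -> value k x <= value k y + d x y.
Proof.
elim: k x y => [|k IH] x y Dx Dy /=; first by rewrite addrC; exact: triangle.
apply/ler_addgt0Pr => e e0.
have [a Aa Ha] := minstep IH Dy e0.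
apply: ge_inf; first by case: (has_inf_step IH Dx).
exists a => // b Bb.
apply: le_trans (IH _ _ (DT Aa Bb Dx) (DT Aa Bb Dy)) _.
have := Ha b Bb; have := hg_nonexp game Aa Bb Dx Dy.
rewrite /=; lra.
Qed.

Lemma value_min k x e : D x -> 0 < e ->
  exists2 a, A a & forall b, B b -> value k (T a b x) <= value k.+1 x + e.
Proof. by apply: minstep; exact: value_lip. Qed.

Lemma value_max k x a e : D x -> A a -> 0 < e ->
  exists2 b, B b & value k.+1 x - e <= value k (T a b x).
Proof. by apply: maxstep; exact: value_lip. Qed.

(** As [d x0 (T a b x0) <= L], one turn lowers the value by at most [L]. This bounds the averages of
    [escape_rate] from below. *)
Lemma value_ge k : d x0 x0 - k%:R * L <= value k x0.
Proof.
elim: k => [|k IH]; first by rewrite mul0r subr0.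
apply/ler_addgt0Pr => e e0.
have [a Aa Ha] := value_min k Dx0 e0.
have [b Bb] := hg_B game; have := Ha b Bb.
have := value_lip k Dx0 (DT Aa Bb Dx0); have := hg_in game Aa Bb.
rewrite mulrSr mulrDl mul1r; lra.
Qed.

(** The infimum of Fekete's lemma; [k.+1] excludes the empty horizon. *)
Definition escape_rate : R := inf [set value k.+1 x0 / k.+1%:R | k in [set: nat]].

Lemma has_inf_rate : has_inf [set value k.+1 x0 / k.+1%:R | k in [set: nat]].
Proof.
split; first by exists (value 1 x0 / 1%:R), 0%N.
exists (- `|d x0 x0| - L) => _ [k _ <-].
rewrite ler_pdivlMr ?ltr0n// mulrBl.
apply: le_trans (value_ge k.+1); rewrite [L * _]mulrC lerB//.
apply: (@le_trans _ _ (- `|d x0 x0|)); last by rewrite lerNl ler_normr lexx orbT.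
by rewrite mulNr lerN2 ler_peMr// ler1n.
Qed.

Lemma escape_rate_le k : k%:R * escape_rate <= value k x0.
Proof.
case: k => [|k]; first by rewrite mul0r /=; have := triangle Dx0 Dx0 Dx0; lra.
rewrite mulrC -ler_pdivlMr ?ltr0n//; apply: ge_inf; last by exists k.
by case: has_inf_rate.
Qed.

Lemma escape_rate_approx e : 0 < e ->
  exists2 m, (0 < m)%N & value m x0 <= m%:R * (escape_rate + e).
Proof.
move=> e0; have [_ [k _ <-] lt_k] := inf_adherent e0 has_inf_rate.
by exists k.+1 => //; move: lt_k; rewrite ltr_pdivrMr ?ltr0n// mulrC => /ltW.
Qed.

Arguments value : simpl never.

(** Sequences of histories consistent with [sigma] cover every behaviour of Max; the same [C] pays
    for the unfinished block in all of them. *)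
Lemma min_guarantee e : 0 < e ->
  exists (sigma : seq (TA * TB) -> TA) (C : R), (forall s, A (sigma s)) /\
    forall s : nat -> seq (TA * TB), s 0%N = [::] ->
    (forall k, exists2 b, B b & s k.+1 = rcons (s k) (sigma (s k), b)) ->
    forall k, d (state (s k)) x0 <= k%:R * (escape_rate + e) + C.
Proof.
move=> e0; have e20 : 0 < e / 2 by rewrite divr_gt0.
have [m m0 Hm] := escape_rate_approx e20.
have /choice[g Hg] : forall yj : X * nat, exists a, A a /\ (D yj.1 ->
    forall b, B b -> value yj.2 (T a b yj.1) <= value yj.2.+1 yj.1 + e / 2).
  move=> [y j]; have [Dy|nDy] := pselect (D y).
    by have [a Aa Ha] := value_min j Dy e20; exists a.
  by have [a Aa] := hg_A game; exists a.
pose step (yr : X * nat) (ab : TA * TB) : X * nat :=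
  if yr.2.+1 == m then (x0, 0%N) else (T ab.1 ab.2 yr.1, yr.2.+1).
(* [sim] is the simulated state together with its number of turns since the
   last restart from [x0]. *)
pose sim s := foldl step (x0, 0%N) s.
(* [g] at index [j] is near-optimal with [j.+1] turns left, hence the predecessor. *)
pose sigma s := g ((sim s).1, (m - (sim s).2).-1).
have Asigma s : A (sigma s) by have [] := Hg ((sim s).1, (m - (sim s).2).-1).
(* Half of [e] pays for the choice of [m], half for the near-optimal actions. *)
pose th := escape_rate + e / 2; rewrite -/th in Hm.
exists sigma, (d x0 x0 + m%:R * `|th| + (m%:R * L + m%:R * L)
  + (d x0 x0 + d x0 x0)); split=> // s s0 sS k.
(* The last bound is on a potential that rises by at most [th + e / 2] per turn: the distance to the
   simulation does not grow, the simulated value rises by at most [e / 2], and one turn fewer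
   remaining adds [th]. *)
have inv : [/\ D (state (s k)), D (sim (s k)).1, ((sim (s k)).2 < m)%N,
  d (sim (s k)).1 x0 <= d x0 x0 + (sim (s k)).2%:R * L
  & d x0 (sim (s k)).1 <= d x0 x0 + (sim (s k)).2%:R * L /\
  d (state (s k)) (sim (s k)).1 + value (m - (sim (s k)).2) (sim (s k)).1
    - (m - (sim (s k)).2)%:R * th <= d x0 x0 + k%:R * (th + e / 2)].
  elim: k => [|k].
    rewrite s0 /= !mul0r !addr0 subn0 lexx; split=> //; split=> //.
    by rewrite -addrA gerDl subr_le0.
  have [b Bb ->] := sS k.
  have : A (sigma (s k)) /\ (D (sim (s k)).1 -> forall b, B b ->
      value (m - (sim (s k)).2).-1 (T (sigma (s k)) b (sim (s k)).1)
      <= value (m - (sim (s k)).2).-1.+1 (sim (s k)).1 + e / 2).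
    exact: Hg ((sim (s k)).1, (m - (sim (s k)).2).-1).
  rewrite state_rcons /sim !foldl_rcons -/(sim _).
  move: (sigma (s k)) => a.
  case: (sim (s k)) => y r /= [Aa Hmin] [Dx Dy ltrm dy0 [d0y pot]].
  have := Hmin Dy b Bb; rewrite prednK ?subn_gt0// => {}Hmin.
  have DTx := DT Aa Bb Dx; have DTy := DT Aa Bb Dy.
  have nonexp := hg_nonexp game Aa Bb Dx Dy.
  have mr : (m - r = (m - r.+1).+1)%N by rewrite subnS prednK ?subn_gt0.
  rewrite mr /= in Hmin; rewrite mr -natr1 in pot.
  have kS : k.+1%:R = k%:R + 1 :> R by rewrite -natr1.
  (* At a restart the remaining [value 0] is a distance to [x0]; the triangle inequality merges it
     into the distance from the true state to the new simulated state [x0], and [Hm] pays for the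
     new block. *)
  rewrite /step /=; case: eqP => [rm|/eqP nrm] /=.
    rewrite rm subnn [value 0 _]/value in Hmin pot.
    rewrite subn0 mul0r addr0 lexx; split=> //; split=> //.
    have := triangle DTx DTy Dx0; rewrite kS; nra.
  have lt_r : (r.+1 < m)%N by rewrite ltn_neqAle nrm.
  have rS : r.+1%:R = r%:R + 1 :> R by rewrite -natr1.
  have := hg_step_in Aa Bb Dy; have := hg_step_out Aa Bb Dy => ho hi.
  rewrite rS kS; split=> //; last split.
  - by rewrite mulrDl mul1r; lra.
  - by rewrite mulrDl mul1r; lra.
  - by nra.
have {inv} := inv; case: (sim (s k)) => y r /= [Dx Dy ltrm dy0 [d0y pot]].
have L0 : 0 <= L.
  have [a Aa] := hg_A game; have [b Bb] := hg_B game.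
  have := hg_in game Aa Bb; have := hg_out game Aa Bb.
  have := triangle Dx0 (DT Aa Bb Dx0) Dx0; have := triangle Dx0 Dx0 Dx0; lra.
(* From the potential back to the distance: [value (m - r) y] is bounded below by comparison with
   [x0], and every other error involves at most [m] turns. *)
have := triangle Dx Dy Dx0; have := triangle Dx0 Dx0 Dx0.
have := value_lip (m - r) Dx0 Dy; have := value_ge (m - r).
have rth : (m - r)%:R * th <= m%:R * `|th|.
  by apply: le_trans (ler_wpM2l _ (ler_norm th)) _ => //;
     rewrite ler_wpM2r// ler_nat leq_subr.
have mrL : (m - r)%:R * L + r%:R * L = m%:R * L.
  by rewrite -mulrDl -natrD subnK// ltnW.
have rL : r%:R * L <= m%:R * L by rewrite ler_wpM2r// ler_nat ltnW.
have -> : escape_rate + e = th + e / 2 by rewrite /th; lra.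
lra.
Qed.

Lemma max_guarantee e : 0 < e ->
  exists tau : seq (TA * TB) -> TA -> TB, (forall s a, A a -> B (tau s a)) /\
    forall s : nat -> seq (TA * TB), s 0%N = [::] ->
    (forall k, exists2 a, A a & s k.+1 = rcons (s k) (a, tau (s k) a)) ->
    forall k, k%:R * (escape_rate - e) - 1 <= d (state (s k)) x0.
Proof.
move=> e0; pose mu := escape_rate - e.
pose excess k := value k x0 - k%:R * mu.
have excess_ge k : k%:R * e <= excess k.
  by have := escape_rate_le k; rewrite /excess /mu mulrBr; lra.
(* Records of [excess]: at these horizons the optimal play keeps up with [mu]
   at every intermediate time. *)
have /choice[rec Hrec] : forall m, exists K, (m <= K)%N /\
    forall j, (j <= K)%N -> excess j <= excess K.
  elim=> [|m [K [mK Krec]]]; first by exists 0%N; split=> // j; rewrite leqn0 => /eqP->.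
  (* [excess] is unbounded by [excess_ge]; the least later time at which it reaches [excess K] again
     is a new record. *)
  have exN : exists N, (K < N)%N && (excess K <= excess N).
    have [N HN] := eventually_le_mul (excess K) e0; exists (maxn K.+1 N).
    rewrite leq_maxl/=; apply: le_trans (excess_ge _).
    exact/HN/leq_maxr.
  case: (ex_minnP exN) => N /andP[KN leKN] Nmin.
  exists N; split; first exact: leq_ltn_trans KN.
  move=> j; rewrite leq_eqVlt => /orP[/eqP->//|jN].
  have [jK|Kj] := leqP j K; first exact: le_trans (Krec _ jK) leKN.
  rewrite (le_trans _ leKN)// ltW// ltNge; apply/negP => leKj.
  by have := Nmin j; rewrite Kj leKj leqNgt jN => /(_ isT).
(* [U] contains every tail, so horizons are arbitrarily large along it. *)
have [U [UU ooU]] := ultraFilterLemma (@eventually_filter).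
have UF : ProperFilter U by exact: ultra_proper.
have Uge j : \forall m \near U, (j <= m)%N by apply: ooU; exists j.
(* [good j x]: from [x] at time [j], most horizons [rec m] still allow their
   full value. *)
pose good j x := forall eta, 0 < eta ->
  \forall m \near U, value (rec m) x0 - eta <= value (rec m - j) x.
(* Each horizon [rec m] has a near-optimal reply [u m]; their limit along [U] is one reply that
   serves most horizons. The thirds of [eta] pay for the earlier tolerance, the near-optimality of
   [u m] and the passage to the limit. *)
have step j x a : D x -> A a -> good j x ->
    exists2 b, B b & good j.+1 (T a b x).
  move=> Dx Aa gx.
  have /choice[u Hu] : forall m, exists b, B b /\
      value (rec m - j.+1).+1 x - m.+1%:R^-1 <= value (rec m - j.+1) (T a b x).
    move=> m; have [|b Bb Hb] := @value_max (rec m - j.+1) x a (m.+1%:R^-1) Dx Aa.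
      by rewrite invr_gt0 ltr0n.
    by exists b.
  have [b Bb Hb] := hg_ultra game UU (fun k => (Hu k).1) Aa Dx.
  exists b => // eta eta0; have eta3 : 0 < eta / 3 by rewrite divr_gt0.
  have small : \forall m \near U, m.+1%:R^-1 <= eta / 3.
    apply: filterS (Uge (Num.truncn (eta / 3)^-1)) => m lem.
    rewrite -[leRHS]invrK lef_pV2 ?posrE ?invr_gt0//.
    by apply: le_trans (ltW (truncnS_gt _)) _; rewrite ler_nat ltnS.
  near=> m.
  have jm : (j.+1 <= rec m)%N.
    by apply: leq_trans (Hrec m).1; near: m; exact: Uge.
  have : value (rec m) x0 - eta / 3 <= value (rec m - j) x.
    by near: m; exact: gx.
  have : m.+1%:R^-1 <= eta / 3 by near: m; exact: small.
  have : d (T a (u m) x) (T a b x) <= eta / 3 by near: m; exact: Hb.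
  have [Bum] := Hu m; rewrite subnSK// => Hum.
  have := value_lip (rec m - j.+1) (DT Aa Bum Dx) (DT Aa Bb Dx).
  by move: Hum; move: (m.+1%:R^-1) => q; lra.
(* The time is the length of the history; the default reply [b0] serves histories that are not
   good. *)
have /choice[tau Htau] : forall sa : seq (TA * TB) * TA, exists b,
    A sa.2 -> B b /\ (D (state sa.1) -> good (size sa.1) (state sa.1) ->
      good (size sa.1).+1 (T sa.2 b (state sa.1))).
  move=> [s a] /=; have [b0 Bb0] := hg_B game.
  have [[Aa [Ds gs]]|H] := pselect (A a /\ D (state s) /\ good (size s) (state s)).
    by have [b Bb Hb] := step _ _ _ Ds Aa gs; exists b.
  by exists b0 => Aa; split=> // Ds gs; case: H.
exists (fun s a => tau (s, a)); split=> [s a Aa|s s0 sS k].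
  by have [] := Htau (s, a) Aa.
have [szs Ds gs] : [/\ size (s k) = k, D (state (s k)) & good k (state (s k))].
  elim: k => [|k [szs Ds gs]].
    rewrite s0; split=> // eta eta0; near=> m; rewrite subn0 /=; lra.
  have [a Aa ->] := sS k; have [/= Bb Hb] := Htau (s k, a) Aa.
  rewrite state_rcons size_rcons szs; split=> //; first exact: DT.
  by rewrite -[in good _]szs; apply: Hb; rewrite ?szs.
(* Tolerance 1 is the constant lost in the statement. As [rec m] is a record, [value (rec m - k) x0]
   is at most [value (rec m) x0 - k%:R * mu], and [value_lip] compares it with the value at the
   current state. *)
have /filter_ex[m [Hm km]] : \forall m \near U,
    value (rec m) x0 - 1 <= value (rec m - k) (state (s k)) /\ (k <= m)%N.
  exact: filterI (gs 1 ltr01) (Uge k).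
have krec : (k <= rec m)%N by exact: leq_trans km (Hrec m).1.
have := (Hrec m).2 _ (leq_subr k (rec m)); rewrite /excess natrB// mulrBl.
have := value_lip (rec m - k) Ds Dx0; rewrite /mu; lra.
Unshelve. all: by end_near. Qed.
End Value.

(** Strategies on action sequences are transported along [acts]; the bounded discrepancy [c]
    vanishes after division by the number of turns. *)
Theorem hemimetric_uniform_value (R : realType) (X TA TB : Type) (D : set X)
    (d : X -> X -> R) (A : set TA) (B : set TB) (T : TA -> TB -> X -> X)
    (x0 : X) (L : R) (H : Type) (h0 : H) (extend : H -> TA -> TB -> H)
    (acts : H -> seq (TA * TB)) (payoff : H -> R) (c : R) :
  hemimetric_game D d A B T x0 L ->
  acts h0 = [::] ->
  (forall h a b, acts (extend h a b) = rcons (acts h) (a, b)) ->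
  (forall sigma tau k, strategyMin A sigma -> strategyMax A B tau ->
    let h := play h0 extend sigma tau k in
    `|payoff h - d (state T x0 (acts h)) x0| <= c) ->
  has_uniform_value A B h0 extend payoff.
Proof.
move=> game acts0 actsS close; exists (escape_rate d A B T x0) => e e0.
have e20 : 0 < e / 2 by rewrite divr_gt0.
have [sigma [C [Asigma Hsigma]]] := min_guarantee game e20.
have [tau [Btau Htau]] := max_guarantee game e20.
have [N1 HN1] := eventually_le_mul (C + c) e20.
have [N2 HN2] := eventually_le_mul (1 + c) e20.
(* The successor makes [k] positive for the division. *)
exists (sigma \o acts), (tau \o acts), (N1 + N2).+1; split.
- by move=> h; exact: Asigma.
- by move=> h a; exact: Btau.
move=> k Nk s t sA tB.
have k0 : 0 < k%:R :> R by rewrite ltr0n; exact: leq_trans Nk.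
have N1k : (N1 <= k)%N by apply: leq_trans (ltnW Nk); exact: leq_addr.
have N2k : (N2 <= k)%N by apply: leq_trans (ltnW Nk); exact: leq_addl.
rewrite ler_pdivrMr// ler_pdivlMr//; split.
- have sA' : strategyMin A (sigma \o acts) by move=> h; exact: Asigma.
  have : d (state T x0 (acts (play h0 extend (sigma \o acts) t k))) x0 <=
      k%:R * (escape_rate d A B T x0 + e / 2) + C.
    apply: (Hsigma (fun k => acts (play h0 extend (sigma \o acts) t k)) acts0) => j.
    exists (t (play h0 extend (sigma \o acts) t j)
      (sigma (acts (play h0 extend (sigma \o acts) t j)))).
      by apply: tB; exact: Asigma.
    by rewrite actsS.
  have := close _ _ k sA' tB; rewrite /= ler_norml => /andP[_].
  have := HN1 _ N1k; nra.
- have tB' : strategyMax A B (tau \o acts) by move=> h a; exact: Btau.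
  have : k%:R * (escape_rate d A B T x0 - e / 2) - 1 <=
      d (state T x0 (acts (play h0 extend s (tau \o acts) k))) x0.
    apply: (Htau (fun k => acts (play h0 extend s (tau \o acts) k)) acts0) => j.
    exists (s (play h0 extend s (tau \o acts) j)); first exact: sA.
    by rewrite actsS.
  have := close _ _ k sA tB'; rewrite /= ler_norml => /andP[+ _].
  have := HN2 _ N2k; nra.
Qed.

(** * The Funk hemi-metric of a proper cone *)

(** Compactness gives a cluster point, and an ultrafilter converges to each of its cluster points
    because it contains every set or its complement. *)
Lemma ultra_compact_cvg (T : topologicalType) (K : set T) (U : set_system nat)
    (u : nat -> T) :
  compact K -> UltraFilter U -> (forall k, K (u k)) ->
  exists2 p, K p & u @ U --> p.
Proof.
move=> cK UU Ku; have UP : ProperFilter U by exact: ultra_proper.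
have [p [Kp clp]] : K `&` cluster (u @ U) !=set0.
  exact: cK (fmap_proper_filter _ _) (filterE _ Ku).
exists p => // V Vp; have [//|nV] := in_ultra_setVsetC (u @^-1` V) UU.
by have [y []] := clp (~` V) V nV Vp.
Qed.

(** Compactness in covering form: bounds that hold locally for all large [M] become uniform. *)
Lemma compact_uniform_bound (R : realType) (T : topologicalType) (K : set T)
    (P : R -> T -> Prop) : compact K ->
  (forall x, K x -> \forall y \near x & M \near +oo, P M y) ->
  \forall M \near +oo, forall x, K x -> P M x.
Proof. by move=> /compact_near_coveringP cK; exact: cK. Qed.

Lemma near_dist_lt (R : realType) (m n : nat) (z : 'M[R]_(m, n)) (r : R) :
  0 < r -> \forall w \near z, `|z - w| < r.
Proof. by move=> r0; apply/nbhs_normP; exists r. Qed.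

Section ProperCone.
Variables (R : realType) (n : nat) (C : set 'rV[R]_n).
Hypotheses (n_gt0 : (0 < n)%N) (pC : proper_cone C).
Implicit Types x y z : 'rV[R]_n.

Lemma cone_interiorP x :
  C° x <-> exists2 r : R, 0 < r & forall y, `|y| < r -> C (x + y).
Proof.
split=> [/nbhs_normP[r /= r0 Hr]|[r r0 Hr]].
  by exists r => // y yr; apply: Hr; rewrite /ball_/= opprD addrA subrr sub0r normrN.
suff : \near x, C x by []; apply/nbhs_normP; exists r => //= y.
rewrite /ball_/= distrC => yr.
by rewrite -(subrK x y) addrC; exact: Hr.
Qed.

Lemma cone_int x : C° x -> C x.
Proof. exact: interior_subset. Qed.

Lemma coneD x y : C x -> C y -> C (x + y).
Proof.
move=> Cx Cy; have h0 : 0 <= 2^-1 :> R by rewrite invr_ge0.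
have h1 : 2^-1 <= 1 :> R by rewrite invf_le1// ler1n.
have := cone_convex pC (x := x) (y := y) (Itv01 h0 h1) (mem_set Cx) (mem_set Cy).
rewrite inE => /(cone_scale pC (ler0n R 2)); congr C.
rewrite /conv /= scalerDr !scalerA divff// scale1r.
have -> : 2 * (1 - 2^-1) = 1 :> R by rewrite mulrBr mulr1 divff//; lra.
by rewrite scale1r.
Qed.

Lemma cone_intDr x y : C° x -> C y -> C° (x + y).
Proof.
move=> /cone_interiorP[r r0 Hr] Cy; apply/cone_interiorP; exists r => // z zr.
by rewrite addrAC; apply: coneD => //; exact: Hr.
Qed.

Lemma cone_intZ t x : 0 < t -> C° x -> C° (t *: x).
Proof.
move=> t0 /cone_interiorP[r r0 Hr]; apply/cone_interiorP.
exists (t * r); first by rewrite mulr_gt0.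
move=> y yr; have -> : t *: x + y = t *: (x + t^-1 *: y).
  by rewrite scalerDr scalerA divff ?scale1r// gt_eqF.
apply: (cone_scale pC (ltW t0)); apply: Hr.
by rewrite normrZ gtr0_norm ?invr_gt0// ltr_pdivrMl.
Qed.

Lemma cone_near_pinfty x z : C° x ->
  \forall M \near +oo, C (x + M^-1 *: z).
Proof.
move=> /cone_interiorP[r r0 Hr]; near=> M.
have M0 : 0 < M by near: M; exact: nbhs_pinfty_gt.
apply: Hr; rewrite normrZ gtr0_norm ?invr_gt0// ltr_pdivrMl//.
rewrite mulrC -ltr_pdivrMl//; near: M; apply: nbhs_pinfty_gt.
by rewrite num_real.
Unshelve. all: by end_near. Qed.

(** If 0 were interior, scaling would make [C] the whole space, against pointedness in positive
    dimension. *)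
Lemma cone_int_neq0 x : C° x -> x != 0.
Proof.
move=> Cx; apply/eqP => x0; have Cy y : C y.
  have /filter_ex[M [M0 CM]] : \forall M \near +oo, (0 : R) < M /\ C (x + M^-1 *: y).
    by near=> M; split; near: M; [exact: nbhs_pinfty_gt|exact: cone_near_pinfty].
  have := cone_scale pC (ltW M0) CM.
  by rewrite x0 add0r scalerA divff ?scale1r// gt_eqF.
have /rowP/(_ (Ordinal n_gt0))/eqP : const_mx 1 = 0 :> 'rV[R]_n.
  by apply: (cone_pointed pC).
by rewrite !mxE oner_eq0.
Unshelve. all: by end_near. Qed.

Lemma cone_closure x y : (forall e, 0 < e -> C (x + e *: y)) -> C x.
Proof.
move=> H; apply: (@closed_cvg _ _ (0 : R)^'+ _ (fun e : R => x + e *: y) C).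
- exact: cone_closed pC.
- by near=> e; apply: H; near: e; exact: nbhs_right_gt.
- rewrite -[X in _ --> X]addr0 -(scale0r y).
  apply: cvgD; first exact: cvg_cst.
  by apply: cvgZr_tmp; apply: cvg_at_right_filter; exact: cvg_id.
Unshelve. all: by end_near. Qed.

(** The infimum is attained because [C] is closed, and positive because otherwise [- x] would lie in
    [C]. From here on [inf] and [ln] can be avoided. *)
Lemma FunkP x y t : C° x -> C° y -> Funk C x y <= t <-> C (expR t *: y - x).
Proof.
move=> Cx Cy.
set S := [set alpha : R | 0 < alpha /\ cone_le C x (alpha *: y)].
have S0 : has_inf S.
  split; last by exists 0 => a [/ltW].
  have /filter_ex[M [M0 CM]] : \forall M \near +oo, (0 : R) < M /\ C (y + M^-1 *: (- x)).
    by near=> M; split; near: M; [exact: nbhs_pinfty_gt|exact: cone_near_pinfty].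
  exists M; split => //; rewrite /cone_le.
  have := cone_scale pC (ltW M0) CM.
  by rewrite scalerDr scalerN scalerN scalerA divff ?scale1r// gt_eqF.
have infS a : inf S < a -> C (a *: y - x).
  move=> ltSa; have [b [b0 Cb] ltba] := inf_adherent (eps := a - inf S)
    ltac:(by rewrite subr_gt0) S0.
  rewrite addrC subrK in ltba.
  rewrite -(subrK (b *: y) (a *: y)) -addrA; apply: coneD => //.
  by rewrite -scalerBl; apply: cone_scale (cone_int Cy) => //; rewrite subr_ge0 ltW.
have CinfS : C (inf S *: y - x).
  apply: (@cone_closure _ y) => e e0; rewrite addrAC -scalerDl; apply: infS.
  by rewrite ltrDl.
have inf0 : 0 < inf S.
  rewrite lt_neqAle lb_le_inf ?andbT; [|by case: S0|by move=> a [/ltW]].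
  apply/eqP => S00; have /eqP := cone_int_neq0 Cx; apply.
  apply: (cone_pointed pC); first exact: cone_int.
  by rewrite -S00 scale0r sub0r in CinfS.
rewrite /Funk -/S; split=> [le_t|Ct].
  have le_exp : inf S <= expR t by rewrite -(lnK (x := inf S)) ?posrE// ler_expR.
  rewrite -(subrK (inf S *: y) (expR t *: y)) -addrA; apply: coneD => //.
  by rewrite -scalerBl; apply: cone_scale (cone_int Cy) => //; rewrite subr_ge0.
rewrite -(expRK t) ler_ln ?posrE ?expR_gt0//.
by apply: ge_inf; [case: S0|split; [exact: expR_gt0|]].
Unshelve. all: by end_near. Qed.

Lemma Funk_le x y : C° x -> C° y -> C (expR (Funk C x y) *: y - x).
Proof. by move=> Cx Cy; apply/FunkP. Qed.

Lemma Funk_triangle x y z : C° x -> C° y -> C° z ->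
  Funk C x z <= Funk C x y + Funk C y z.
Proof.
move=> Cx Cy Cz; apply/FunkP => //; rewrite expRD -scalerA.
rewrite -(subrK (expR (Funk C x y) *: y) (_ *: (_ *: z))) -addrA.
apply: coneD; last exact: Funk_le.
by rewrite -scalerBr; apply: cone_scale (Funk_le Cy Cz) => //; exact: expR_ge0.
Qed.

(** Balls inside [C] around [x] and around a point of [K] absorb the other vector divided by a large
    [M]; covering [K] makes [M] uniform. *)
Lemma compact_cone_dominated (K : set 'rV[R]_n) x :
  compact K -> K `<=` C° -> C° x ->
  exists t : R, forall z, K z -> Funk C x z <= t /\ Funk C z x <= t.
Proof.
move=> cK KC Cx; have [r r0 Hr] := (cone_interiorP x).1 Cx.
have /filter_ex[M [M0 HM]] : \forall M \near +oo, 0 < M /\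
    forall z, K z -> C (M *: z - x) /\ C (M *: x - z).
  near=> M; split; first by near: M; exact: nbhs_pinfty_gt.
  near: M; apply: compact_uniform_bound => // z0 Kz0.
  have [s s0 Hs] := (cone_interiorP z0).1 (KC _ Kz0).
  near=> z M.
  have M0 : 0 < M by near: M; exact: nbhs_pinfty_gt.
  have zz0 : `|z0 - z| < Num.min 1 (s / 2).
    by near: z; apply: near_dist_lt; rewrite lt_min ltr01 divr_gt0.
  move: zz0; rewrite lt_min => /andP[zz1 zzs]; split.
  - have -> : M *: z - x = M *: (z0 + ((z - z0) - M^-1 *: x)).
      rewrite addrA subrKC scalerBr scalerA divff ?scale1r// gt_eqF//.
    apply: (cone_scale pC (ltW M0)); apply: Hs.
    apply: le_lt_trans (ler_normB _ _) _.
    rewrite -(addrK (s / 2) s) distrC normrZ gtr0_norm ?invr_gt0//.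
    have : M^-1 * `|x| < s / 2.
      rewrite ltr_pdivrMl// mulrC -ltr_pdivrMl ?divr_gt0//; near: M.
      by apply: nbhs_pinfty_gt; rewrite num_real.
    lra.
  - have -> : M *: x - z = M *: (x + - (M^-1 *: z)).
      by rewrite scalerBr scalerA divff ?scale1r// gt_eqF//.
    apply: (cone_scale pC (ltW M0)); apply: Hr.
    rewrite normrN normrZ gtr0_norm ?invr_gt0//.
    rewrite ltr_pdivrMl// mulrC -ltr_pdivrMl ?divr_gt0//.
    apply: (@le_lt_trans _ _ (r^-1 * (`|z0| + 1))).
      rewrite ler_pM2l ?invr_gt0// -[z](subrK z0) addrC.
      by apply: le_trans (ler_normD _ _) _; rewrite lerD2l distrC ltW.
    by near: M; apply: nbhs_pinfty_gt; rewrite num_real.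
exists (ln M) => z Kz; have Cz := KC _ Kz; have [H1 H2] := HM z Kz.
by split; apply/FunkP; rewrite ?lnK.
Unshelve. all: by end_near. Qed.

(** The interior vector [(expR e - 1) *: z] absorbs the small vector [z - w]. *)
Lemma Funk_near0 z e : C° z -> 0 < e -> \forall w \near z, C° w -> Funk C w z <= e.
Proof.
move=> Cz e0; have e1 : 0 < expR e - 1 by rewrite subr_gt0 expR_gt1.
have /cone_interiorP[r r0 Hr] := cone_intZ e1 Cz.
near=> w => Cw; apply/FunkP => //.
have -> : expR e *: z - w = (expR e - 1) *: z + (z - w).
  by rewrite scalerBl scale1r addrA subrK.
apply: Hr; near: w; exact: near_dist_lt.
Unshelve. all: by end_near. Qed.

End ProperCone.

(** This supplies [hg_ultra] for cones: [b] is the limit of [u] along [U]. *)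
Lemma Funk_ultra (R : realType) (n : nat) (n_gt0 : (0 < n)%N)
    (C : set 'rV[R]_n) (pC : proper_cone C) (TB : topologicalType) (B : set TB)
    (f : TB -> 'rV[R]_n) (U : set_system nat) (u : nat -> TB) :
  compact B -> {within B, continuous f} -> (forall b, B b -> C° (f b)) ->
  UltraFilter U -> (forall k, B (u k)) ->
  exists2 b, B b & forall e, 0 < e ->
    \forall k \near U, Funk C (f (u k)) (f b) <= e.
Proof.
move=> cB /subspace_continuousP fc fC UU Bu.
have [b Bb ub] := ultra_compact_cvg cB UU Bu; exists b => // e e0.
have UF : ProperFilter U by exact: ultra_proper.
have near_f : \forall y \near b, B y -> C° (f y) -> Funk C (f y) (f b) <= e.
  exact: fc b Bb _ (Funk_near0 n_gt0 pC (fC _ Bb) e0).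
have {}near_f : \forall k \near U, B (u k) -> C° (f (u k)) ->
  Funk C (f (u k)) (f b) <= e by exact: ub near_f.
by apply: filterS near_f => k H; apply: H; [exact: Bu|exact: fC].
Qed.

(** Applying [T a b] to [x <= expR (Funk C x y) *: y] gives nonexpansiveness by homogeneity; the
    standing compactness assumption for the singleton of [x0] gives [L]. *)
Lemma conical_hemimetric_game (R : realType) (n : nat) (n_gt0 : (0 < n)%N)
    (TA TB : topologicalType) (C : set 'rV[R]_n) (A : set TA) (B : set TB)
    (T : TA -> TB -> 'rV[R]_n -> 'rV[R]_n) (x0 : 'rV[R]_n) :
  conical_escape_rate_game C A B T -> C° x0 ->
  exists L, hemimetric_game C° (Funk C) A B T x0 L.
Proof.
move=> G Cx0; have pC := game_cone G.
have Tint := game_interior G.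
have [|z [a [b [x [Aa Bb -> ->]]]]|L HL] :=
  compact_cone_dominated n_gt0 pC (game_compact G (@compact_set1 _ x0) _) _ Cx0.
- by move=> _ ->.
- exact: Tint.
have {}HL a b : A a -> B b ->
    Funk C x0 (T a b x0) <= L /\ Funk C (T a b x0) x0 <= L.
  by move=> Aa Bb; apply: HL; exists a, b, x0.
exists L; split=> //.
- exact: game_A_nonempty G.
- exact: game_B_nonempty G.
- by move=> *; exact: Funk_triangle.
- move=> a b x y Aa Bb Cx Cy; have CTx := Tint _ _ _ Aa Bb Cx.
  have CTy := Tint _ _ _ Aa Bb Cy.
  apply/FunkP => //; rewrite -(game_homogeneous G)// ?expR_gt0//.
  apply: (game_order_preserving G) => //; last exact: Funk_le.
  by apply: cone_intZ => //; exact: expR_gt0.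
- by move=> a b Aa Bb; have [] := HL _ _ Aa Bb.
- by move=> a b Aa Bb; have [] := HL _ _ Aa Bb.
- move=> U u a x UU Bu Aa Cx.
  apply: (Funk_ultra n_gt0 pC (game_B_compact G)) => // [|b Bb].
    exact: (game_continuous_B G).
  exact: Tint.
Qed.

Lemma escape_uniform_value (R : realType) (n : nat) (n_gt0 : (0 < n)%N)
    (TA TB : topologicalType) (C : set 'rV[R]_n) (A : set TA) (B : set TB)
    (T : TA -> TB -> 'rV[R]_n -> 'rV[R]_n) (x0 : 'rV[R]_n) :
  conical_escape_rate_game C A B T -> C° x0 ->
  escape_game_has_uniform_value C A B T x0.
Proof.
move=> G Cx0; have [L HG] := conical_hemimetric_game n_gt0 G Cx0.
(* The recorded states are those that the actions produce, so the payoff is exactly the distance and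
   [c] is 0. *)
apply: (hemimetric_uniform_value (acts := fun h => [seq abx.1 | abx <- h.2])
  (c := 0) HG) => // [h a b|sigma tau k _ _].
  by rewrite map_rcons.
set h := play _ _ _ _ _ => /=.
suff [h1 hs] : h.1 = x0 /\ current_state h = state T x0 [seq abx.1 | abx <- h.2].
  by rewrite /escape_payoff h1 hs subrr normr0.
rewrite {}/h; elim: k => //= k [h1 hs]; split=> //.
by rewrite /current_state /= !map_rcons last_rcons state_rcons -hs.
Qed.

(** * Matrix norms *)

Lemma unit_sphere_compact (R : realType) (p : nat) :
  compact [set v : 'rV[R]_p | `|v| = 1].
Proof.
apply: bounded_closed_compact.
  by exists 1; split=> // x x1 v /= ->; exact: ltW.
have -> : [set v : 'rV[R]_p | `|v| = 1] = Num.norm @^-1` [set 1] by [].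
apply: closed_comp => [v _|]; first exact: norm_continuous.
exact: closed_eq.
Qed.

(** * Equivalence of norms on a finite-dimensional real space *)

Section NormEquivalence.
Variables (R : realType) (p : nat) (N : 'rV[R]_p -> R).
Hypothesis N_eq0 : forall v, N v = 0 -> v = 0.
Hypothesis NZ : forall (t : R) v, N (t *: v) = `|t| * N v.
Hypothesis ND : forall v w, N (v + w) <= N v + N w.

Lemma mx_norm_ge_entry m n (M : 'M[R]_(m, n)) i j : `|M i j| <= `|M|.
Proof.
rewrite [leRHS]/Num.norm /= mx_normrE.
exact: (le_bigmax _ (fun ij : 'I_m * 'I_n => `|M ij.1 ij.2|) (i, j)).
Qed.

Let N0 : N 0 = 0.
Proof. by rewrite -(scale0r 0) NZ normr0 mul0r. Qed.

Let NN v : N (- v) = N v.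
Proof. by rewrite -scaleN1r NZ normrN1 mul1r. Qed.

Let N_ge0 v : 0 <= N v.
Proof. by have := ND v (- v); rewrite subrr N0 NN -mulr2n pmulrn_lge0. Qed.

Let N_bounded : exists2 S, 0 < S & forall v, N v <= S * `|v|.
Proof.
exists (\sum_j N (delta_mx 0 j) + 1).
  by rewrite ltr_wpDl// sumr_ge0.
move=> v; rewrite {1}(row_sum_delta v).
apply: (@le_trans _ _ (\sum_j N (v 0 j *: delta_mx 0 j))).
  elim/big_ind2: _ => [|x y x' y' le1 le2|//]; first by rewrite N0.
  by apply: le_trans (ND _ _) _; rewrite lerD.
rewrite mulrDl mul1r ler_wpDr// mulr_suml ler_sum// => j _.
by rewrite NZ mulrC ler_wpM2l// mx_norm_ge_entry.
Qed.

(** [N] is positive on the compact unit sphere and continuous by [N_bounded], hence bounded away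
    from 0 there; homogeneity extends the bound. *)
Lemma rV_norm_lower : exists2 c, 0 < c & forall v, c * `|v| <= N v.
Proof.
have [S S0 HS] := N_bounded.
have /filter_ex[M [M0 HM]] : \forall M \near +oo, 0 < M /\
    forall v : 'rV[R]_p, `|v| = 1 -> 1 <= M * N v.
  near=> M; split; first by near: M; exact: nbhs_pinfty_gt.
  near: M; apply: (compact_uniform_bound (P := fun M v => 1 <= M * N v)
    (@unit_sphere_compact R p)).
  move=> v0 /= v01.
  have Nv0 : 0 < N v0.
    rewrite lt_neqAle N_ge0 andbT eq_sym; apply/eqP => /N_eq0 v00.
    by move: v01; rewrite v00 normr0 => /esym/eqP; rewrite oner_eq0.
  near=> v M.
  have M0 : 0 < M by near: M; exact: nbhs_pinfty_gt.
  have vv0 : `|v0 - v| < S^-1 * (N v0 / 2).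
    by near: v; apply: near_dist_lt; rewrite mulr_gt0 ?invr_gt0 ?divr_gt0.
  have HM : 2 / N v0 < M by near: M; apply: nbhs_pinfty_gt; rewrite num_real.
  have : N v0 / 2 <= N v.
    have := ND (v0 - v) v; rewrite subrK; have := HS (v0 - v).
    rewrite ltr_pdivlMl// in vv0; lra.
  rewrite ltr_pdivrMr// in HM; move=> Nv.
  apply: (@le_trans _ _ (M * (N v0 / 2))); last by rewrite ler_pM2l.
  by rewrite mulrA ler_pdivlMr// mul1r ltW.
exists M^-1; rewrite ?invr_gt0// => v.
have [->|v0] := eqVneq v 0; first by rewrite normr0 mulr0.
have nv0 : 0 < `|v| by rewrite normr_gt0.
have := HM (`|v|^-1 *: v); rewrite normrZ normfV normr_id mulVf ?gt_eqF//.
move=> /(_ erefl); rewrite NZ normfV normr_id => H.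
rewrite ler_pdivrMl// -(ler_pM2l (x := `|v|^-1)) ?invr_gt0//.
by rewrite mulVf ?gt_eqF// mulrCA.
Unshelve. all: by end_near. Qed.

End NormEquivalence.

(** * A submultiplicative norm on complex matrices *)

Section RowSumNorm.
Variables (R : realType) (n : nat).
Local Notation Mn := 'M[complexField R]_n.
Local Notation normc := ComplexField.Normc.normc.
Implicit Types M P : Mn.

Lemma normc_ge0 (z : complexField R) : 0 <= normc z.
Proof. by case: z => a b; rewrite /normc sqrtr_ge0. Qed.

Lemma normcD_le (z w : complexField R) : normc (z + w) <= normc z + normc w.
Proof. exact: le_normcD. Qed.

Lemma normcB_sym (z w : complexField R) : normc (z - w) = normc (w - z).
Proof. by rewrite -opprB; exact: (@normcN R (w - z)). Qed.

(** The operator norm induced by the maximum norm on column vectors. *)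
Definition row_sum_norm M : R :=
  \big[Num.max/0]_(i < n) \sum_(j < n) normc (M i j).

Lemma row_sum_norm_ge M i : \sum_(j < n) normc (M i j) <= row_sum_norm M.
Proof. exact: le_bigmax. Qed.

Lemma row_sum_norm_le M c : 0 <= c ->
  (forall i, \sum_(j < n) normc (M i j) <= c) -> row_sum_norm M <= c.
Proof. by move=> c0 Hc; apply: bigmax_le. Qed.

Lemma row_sum_norm_ge0 M : 0 <= row_sum_norm M.
Proof.
rewrite /row_sum_norm; elim/big_rec: _ => // i x _ x0.
by rewrite le_max x0 orbT.
Qed.

Lemma row_sum_norm_entry M i j : normc (M i j) <= row_sum_norm M.
Proof.
apply: le_trans (row_sum_norm_ge M i).
by rewrite (bigD1 j)//= lerDl sumr_ge0// => k _; exact: normc_ge0.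
Qed.

Lemma row_sum_norm_entries M c : 0 <= c ->
  (forall i j, normc (M i j) <= c) -> row_sum_norm M <= n%:R * c.
Proof.
move=> c0 Hc; apply: row_sum_norm_le => [|i]; first by rewrite mulr_ge0.
apply: le_trans (ler_sum _ (fun j _ => Hc i j)) _.
by rewrite sumr_const card_ord mulr_natl.
Qed.

Lemma row_sum_normM M P :
  row_sum_norm (M *m P) <= row_sum_norm M * row_sum_norm P.
Proof.
apply: row_sum_norm_le => [|i]; first by rewrite mulr_ge0 ?row_sum_norm_ge0.
apply: (@le_trans _ _ (\sum_j \sum_k normc (M i k) * normc (P k j))).
  apply: ler_sum => j _; rewrite mxE.
  elim/big_ind2: _ => [|x y x' y' le1 le2|k _].
  - by rewrite ComplexField.Normc.normc0.
  - by apply: le_trans (normcD_le _ _) _; rewrite lerD.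
  - by rewrite ComplexField.Normc.normcM.
rewrite exchange_big /=.
apply: (@le_trans _ _ (\sum_k normc (M i k) * row_sum_norm P)).
  by apply: ler_sum => k _; rewrite -mulr_sumr ler_wpM2l ?normc_ge0// row_sum_norm_ge.
by rewrite -mulr_suml ler_wpM2r ?row_sum_norm_ge0// row_sum_norm_ge.
Qed.

Lemma row_sum_normD M P :
  row_sum_norm (M + P) <= row_sum_norm M + row_sum_norm P.
Proof.
apply: row_sum_norm_le => [|i]; first by rewrite addr_ge0 ?row_sum_norm_ge0.
apply: le_trans (lerD (row_sum_norm_ge M i) (row_sum_norm_ge P i)).
by rewrite -big_split; apply: ler_sum => j _; rewrite mxE; exact: normcD_le.
Qed.

Lemma row_sum_normN M : row_sum_norm (- M) = row_sum_norm M.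
Proof.
apply: eq_bigr => i _; apply: eq_bigr => j _.
by rewrite mxE; exact: (@normcN R).
Qed.

Lemma row_sum_norm1 : row_sum_norm 1%:M <= 1.
Proof.
apply: row_sum_norm_le => // i; rewrite (bigD1 i)//= mxE eqxx.
rewrite ComplexField.Normc.normc1 big1 ?addr0// => j ij.
by rewrite mxE eq_sym (negPf ij) ComplexField.Normc.normc0.
Qed.

Lemma row_sum_norm_eq0 M : row_sum_norm M = 0 -> M = 0.
Proof.
move=> M0; apply/matrixP => i j; rewrite mxE; apply: ComplexField.Normc.eq0_normc.
by apply/eqP; rewrite eq_le normc_ge0 andbT -M0 row_sum_norm_entry.
Qed.

Lemma row_sum_norm_gt0 M : M != 0 -> 0 < row_sum_norm M.
Proof.
move=> M0; rewrite lt_neqAle row_sum_norm_ge0 andbT eq_sym.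
by apply: contra_neq M0; exact: row_sum_norm_eq0.
Qed.

Lemma row_sum_norm_near M e : 0 < e ->
  \forall P \near M, row_sum_norm (P - M) <= e.
Proof.
move=> e0; have d0 : 0 < e / (n.+1)%:R by rewrite divr_gt0.
have : nbhs M (ball M ((e / (n.+1)%:R)%:C%C : complexField R)).
  by apply: nbhsx_ballx; rewrite ltcR.
apply: filterS => P [_ HP].
apply: (@le_trans _ _ (n%:R * (e / (n.+1)%:R))).
  apply: row_sum_norm_entries => [|i j]; first exact: ltW.
  rewrite !mxE normcB_sym; apply: ltW; have := HP i j.
  by rewrite -ball_normE /= normc_def ltcR; case: (M i j - P i j).
by rewrite mulrCA ger_pMr// ler_pdivrMr// mul1r ler_nat.
Qed.

End RowSumNorm.

(** * Comparison of an arbitrary matrix norm with the row sum norm *)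

Section MatrixNorm.
Variables (R : realType) (n : nat).
Local Notation Mn := 'M[complexField R]_n.
Local Notation normc := ComplexField.Normc.normc.

(** Complex matrices become real vectors, real parts first, so that [rV_norm_lower] applies. *)
Definition complex_mx (v : 'rV[R]_(n * n + n * n)) : Mn :=
  \matrix_(i, j) Complex (v 0 (lshift _ (mxvec_index i j)))
                         (v 0 (rshift _ (mxvec_index i j))).

Definition real_coords (M : Mn) : 'rV[R]_(n * n + n * n) :=
  row_mx (mxvec (map_mx (@complex.Re R) M)) (mxvec (map_mx (@complex.Im R) M)).

Lemma real_coordsK : cancel real_coords complex_mx.
Proof.
move=> M; apply/matrixP => i j; rewrite mxE row_mxEl row_mxEr !mxvecE !mxE.
by case: (M i j).
Qed.

Lemma complex_mx_entry v i j : normc (complex_mx v i j) <= 2 * `|v|.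
Proof.
rewrite mxE /=.
have le_abs (a b : R) : Num.sqrt (a ^+ 2 + b ^+ 2) <= `|a| + `|b|.
  rewrite -(ler_pXn2r (n := 2)) ?nnegrE ?sqrtr_ge0 ?addr_ge0//.
  rewrite sqr_sqrtr ?addr_ge0 ?sqr_ge0// sqrrD !real_normK ?num_real//.
  by rewrite addrAC lerDl mulrn_wge0// mulr_ge0.
apply: le_trans (le_abs _ _) _; rewrite mulr_natl mulr2n.
by rewrite lerD ?mx_norm_ge_entry.
Qed.

Lemma matrix_norm_equiv (nm : Mn -> R) : matrix_norm nm ->
  exists c1 c2, [/\ 0 < c1, 0 < c2 & forall M,
    c1 * row_sum_norm M <= nm M /\ nm M <= c2 * row_sum_norm M].
Proof.
case=> nm_eq0 nmZ nmD.
have nm0 : nm 0 = 0.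
  by rewrite -(scale0r 0) nmZ ComplexField.Normc.normc0 mul0r.
have nmN M : nm (- M) = nm M.
  by rewrite -scaleN1r nmZ (@normcN R) ComplexField.Normc.normc1 mul1r.
have nm_ge0 M : 0 <= nm M.
  by have := nmD M (- M); rewrite subrr nm0 nmN -mulr2n pmulrn_lge0.
have [c c0 Hc] : exists2 c, 0 < c & forall v, c * `|v| <= nm (complex_mx v).
  apply: rV_norm_lower => [v /nm_eq0 v0|t v|v w].
  - apply/rowP => k; rewrite mxE.
    case: (split_ordP k) => l ->; case: (mxvec_indexP l) => i j.
      by have /matrixP/(_ i j) := v0; rewrite !mxE => -[].
    by have /matrixP/(_ i j) := v0; rewrite !mxE => -[].
  - have -> : complex_mx (t *: v) = (t%:C%C : complexField R) *: complex_mx v.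
      by apply/matrixP => i j; rewrite !mxE /=; apply/eqP;
        rewrite eq_complex /= !mul0r subr0 addr0 !eqxx.
    by rewrite nmZ /= expr0n addr0 sqrtr_sqr.
  - have -> : complex_mx (v + w) = complex_mx v + complex_mx w.
      by apply/matrixP => i j; rewrite !mxE.
    exact: nmD.
(* A row has [n] entries, each at most twice the norm of the coordinates; the upper constant comes
   from the expansion in elementary matrices. [n.+1] and [+ 1] keep both constants positive. *)
exists (c / (n.+1%:R * 2)), (\sum_i \sum_j nm (delta_mx i j) + 1).
split=> [||M]; first by rewrite divr_gt0.
  by rewrite ltr_wpDl//; apply: sumr_ge0 => i _; apply: sumr_ge0.
split.
  rewrite -{2}(real_coordsK M); apply: le_trans (Hc _).
  rewrite mulrAC ler_pdivrMr// -mulrA ler_pM2l//.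
  apply: (@le_trans _ _ (n%:R * (2 * `|real_coords M|))).
    apply: row_sum_norm_entries => [|i j]; first by rewrite mulr_ge0.
    by rewrite -{1}(real_coordsK M) complex_mx_entry.
  by rewrite [leRHS]mulrC -mulrA ler_wpM2r ?mulr_ge0// ler_nat leqnSn.
rewrite mulrDl mul1r ler_wpDr ?row_sum_norm_ge0// {1}(matrix_sum_delta M).
rewrite mulr_suml; elim/big_ind2: _ => [|x y x' y' le1 le2|i _].
- by rewrite nm0.
- by apply: le_trans (nmD _ _) _; rewrite lerD.
rewrite mulr_suml; elim/big_ind2: _ => [|x y x' y' le1 le2|j _].
- by rewrite nm0.
- by apply: le_trans (nmD _ _) _; rewrite lerD.
by rewrite nmZ mulrC ler_wpM2l// row_sum_norm_entry.
Qed.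

Lemma ln_matrix_norm_equiv (nm : Mn -> R) : matrix_norm nm ->
  exists c, forall M, M != 0 -> `|ln (nm M) - ln (row_sum_norm M)| <= c.
Proof.
move=> /matrix_norm_equiv[c1 [c2 [c10 c20 H]]].
exists (`|ln c1| + `|ln c2|) => M /row_sum_norm_gt0 M0.
have [le1 le2] := H M; have nM0 : 0 < nm M.
  by apply: lt_le_trans le1; rewrite mulr_gt0.
have : ln c1 + ln (row_sum_norm M) <= ln (nm M).
  by rewrite -lnM ?posrE// ler_ln ?posrE ?mulr_gt0.
have : ln (nm M) <= ln c2 + ln (row_sum_norm M).
  by rewrite -lnM ?posrE// ler_ln ?posrE ?mulr_gt0.
have := ler_norm (ln c2); have := lerNnormlW (lexx `|ln c1|).
have := normr_ge0 (ln c2); have := normr_ge0 (ln c1).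
by move=> *; rewrite ler_norml; apply/andP; split; lra.
Qed.

End MatrixNorm.

(** * The hemi-metric on invertible matrices *)

Section InvertibleMatrices.
Variables (R : realType) (n : nat).
Hypothesis n_gt0 : (0 < n)%N.
Local Notation Mn := 'M[complexField R]_n.
Implicit Types M P : Mn.

(* Right multiplication by an invertible matrix is an isometry for this
   hemi-metric. *)
Definition right_dist M P : R := ln (row_sum_norm (M *m invmx P)).

Lemma unitmx_row_sum_gt0 M : M \in unitmx -> 0 < row_sum_norm M.
Proof.
move=> uM; apply: row_sum_norm_gt0; apply/eqP => M0.
have : 1%:M = 0 :> Mn by rewrite -(mulmxV uM) M0 mul0mx.
move/matrixP/(_ (Ordinal n_gt0) (Ordinal n_gt0))/eqP.
by rewrite !mxE eqxx oner_eq0.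
Qed.

Lemma ln_row_sumM M P : M \in unitmx -> P \in unitmx ->
  ln (row_sum_norm (M *m P)) <= ln (row_sum_norm M) + ln (row_sum_norm P).
Proof.
move=> uM uP; have M0 := unitmx_row_sum_gt0 uM; have P0 := unitmx_row_sum_gt0 uP.
rewrite -lnM ?posrE// ler_ln ?posrE ?row_sum_normM ?mulr_gt0//.
by apply: unitmx_row_sum_gt0; rewrite unitmx_mul uM.
Qed.

(** Near [M0], the identity [VM] bounds the norm of the inverse of [M] by [q] plus half of itself,
    hence by [2 * q]; compactness makes the bound uniform. *)
Lemma compact_row_sum_bounded (A : set Mn) : compact A ->
  (A `<=` [set M | M \in unitmx]) ->
  exists L, forall M, A M ->
    ln (row_sum_norm M) <= L /\ ln (row_sum_norm (invmx M)) <= L.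
Proof.
move=> cA uA; have /filter_ex[L [L0 HL]] : \forall L \near +oo, 0 < L /\
    forall M, A M -> row_sum_norm M <= L /\
      (M \in unitmx -> row_sum_norm (invmx M) <= L).
  near=> L; split; first by near: L; exact: nbhs_pinfty_gt.
  near: L; apply: compact_uniform_bound => // M0 AM0.
  have uM0 := uA _ AM0; have uV0 : invmx M0 \in unitmx by rewrite unitmx_inv.
  pose q := row_sum_norm (invmx M0).
  have q0 : 0 < q by exact: unitmx_row_sum_gt0.
  near=> M L'; rewrite /=; have near1 : row_sum_norm (M - M0) <= 1.
    by near: M; exact: row_sum_norm_near.
  have near2 : row_sum_norm (M - M0) <= (2 * q)^-1.
    by near: M; apply: row_sum_norm_near; rewrite invr_gt0 mulr_gt0.
  split.
    rewrite -[M](subrK M0); apply: le_trans (row_sum_normD _ _) _.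
    apply: (@le_trans _ _ (1 + row_sum_norm M0)); first by rewrite lerD2r.
    by near: L'; apply: nbhs_pinfty_ge; rewrite num_real.
  move=> uM; apply: (@le_trans _ _ (2 * q)); last first.
    by near: L'; apply: nbhs_pinfty_ge; rewrite num_real.
  have VM : invmx M = invmx M0 + - (invmx M0 *m (M - M0) *m invmx M).
    rewrite mulmxBr mulmxBl mulVmx// mul1mx -mulmxA mulmxV// mulmx1.
    by rewrite opprB addrC subrK.
  have := row_sum_normD (invmx M0) (- (invmx M0 *m (M - M0) *m invmx M)).
  rewrite -VM row_sum_normN -/q.
  have : row_sum_norm (invmx M0 *m (M - M0) *m invmx M) <=
      2^-1 * row_sum_norm (invmx M).
    apply: le_trans (row_sum_normM _ _) _; rewrite ler_wpM2r ?row_sum_norm_ge0//.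
    apply: le_trans (row_sum_normM _ _) _.
    apply: (@le_trans _ _ (q * (2 * q)^-1)); first by rewrite ler_pM2l.
    by rewrite invfM mulrCA divff ?mulr1// gt_eqF.
  lra.
exists (ln L) => M AM; have uM := uA _ AM; have [H1 H2] := HL _ AM.
have M0 := unitmx_row_sum_gt0 uM.
have V0 : 0 < row_sum_norm (invmx M).
  by apply: unitmx_row_sum_gt0; rewrite unitmx_inv.
by split; rewrite ler_ln ?posrE ?H2.
Unshelve. all: by end_near. Qed.

End InvertibleMatrices.

(** * Matrix multiplication games *)

Lemma big_mulmx_rcons (S : pzSemiRingType) (n : nat) (s : seq ('M[S]_n * 'M[S]_n)) a b :
  \big[mulmx/1%:M]_(ab <- rcons s (a, b)) (ab.1 *m ab.2) =
  (\big[mulmx/1%:M]_(ab <- s) (ab.1 *m ab.2)) *m a *m b.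
Proof.
elim: s => [|ab s IH] /=; first by rewrite big_cons !big_nil mul1mx mulmx1.
by rewrite !big_cons IH !mulmxA.
Qed.

(** * Multiplication games of invertible matrices *)

Section InvertibleGame.
Variables (R : realType) (n : nat).
Hypothesis n_gt0 : (0 < n)%N.
Local Notation Mn := 'M[complexField R]_n.
Variables (A B : set Mn).
Hypotheses (A0 : A !=set0) (cA : compact A) (B0 : B !=set0) (cB : compact B).
Hypotheses (uA : A `<=` [set M | M \in unitmx]).
Hypotheses (uB : B `<=` [set M | M \in unitmx]).

Let T (a b x : Mn) : Mn := x *m a *m b.

Lemma invertible_hemimetric_game : exists L,
  hemimetric_game [set M | M \in unitmx] (@right_dist R n) A B T 1%:M L.
Proof.
have [LA HA] := compact_row_sum_bounded n_gt0 cA uA.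
have [LB HB] := compact_row_sum_bounded n_gt0 cB uB.
have uT a b x : A a -> B b -> x \in unitmx -> T a b x \in unitmx.
  by move=> /uA ua /uB ub ux; rewrite !unitmx_mul ux ua ub.
exists (LA + LB); split; [exact: unitmx1|exact: A0|exact: B0|exact: uT|..].
- move=> x y z /= ux uy uz; rewrite /right_dist.
  have -> : x *m invmx z = (x *m invmx y) *m (y *m invmx z).
    by rewrite -mulmxA mulKmx.
  by apply: ln_row_sumM; rewrite // unitmx_mul ?unitmx_inv ?ux ?uy ?uz.
- move=> a b x y Aa Bb /= ux uy; have uTy := uT _ _ _ Aa Bb uy.
  rewrite /right_dist.
  have -> : T a b x = x *m invmx y *m T a b y.
    by rewrite /T !mulmxA mulmxKV.
  by rewrite mulmxK.
- move=> a b Aa Bb; rewrite /right_dist /T mul1mx invmx1 mulmx1.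
  apply: le_trans (ln_row_sumM n_gt0 (uA Aa) (uB Bb)) _.
  exact: lerD (HA _ Aa).1 (HB _ Bb).1.
- move=> a b Aa Bb; rewrite /right_dist /T !mul1mx.
  have ua := uA Aa; have ub := uB Bb.
  have -> : invmx (a *m b) = invmx b *m invmx a.
    have uab : a *m b \in unitmx by rewrite unitmx_mul ua ub.
    by rewrite -[RHS](mulmxK uab) !mulmxA mulmxKV// mulVmx// mul1mx.
  have uVa : invmx a \in unitmx by rewrite unitmx_inv.
  have uVb : invmx b \in unitmx by rewrite unitmx_inv.
  apply: le_trans (ln_row_sumM n_gt0 uVb uVa) _; rewrite [LA + LB]addrC.
  exact: lerD (HB _ Bb).2 (HA _ Aa).2.
move=> U u a x UU Bu Aa /= ux.
have [b Bb ub] := ultra_compact_cvg cB UU Bu; exists b => // e e0.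
have UF : ProperFilter U by exact: ultra_proper.
have uw := uT _ _ _ Aa Bb ux.
(* Replacing [b] by [u k] turns the quotient 1 into [1 + x a (u k - b) w^-1] with [w = T a b x], of
   norm at most [1 + q * (e / q)], hence at most [expR e]. *)
pose q := row_sum_norm (x *m a) * row_sum_norm (invmx (T a b x)).
have q0 : 0 < q.
  have uxa : x *m a \in unitmx by rewrite unitmx_mul ux; exact: uA.
  have uVw : invmx (T a b x) \in unitmx by rewrite unitmx_inv.
  exact: mulr_gt0 (unitmx_row_sum_gt0 n_gt0 uxa) (unitmx_row_sum_gt0 n_gt0 uVw).
have e0q : 0 < e / q by rewrite divr_gt0.
have near_b : \forall k \near U, row_sum_norm (u k - b) <= e / q.
  exact: ub (row_sum_norm_near b e0q).
apply: filterS near_b => k ukb.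
have uwk := uT _ _ _ Aa (Bu k) ux.
have -> : e = ln (expR e) by rewrite expRK.
have uwkw : T a (u k) x *m invmx (T a b x) \in unitmx.
  by rewrite unitmx_mul unitmx_inv uwk.
rewrite /right_dist ler_ln ?posrE ?expR_gt0 ?(unitmx_row_sum_gt0 n_gt0 uwkw)//.
have -> : T a (u k) x *m invmx (T a b x) =
    1%:M + x *m a *m (u k - b) *m invmx (T a b x).
  have wV : x *m a *m b *m invmx (T a b x) = 1%:M.
    exact: mulmxV uw.
  by rewrite mulmxBr mulmxBl wV addrC subrK.
apply: le_trans (row_sum_normD _ _) _.
apply: (@le_trans _ _ (1 + e)); last exact: expR_ge1Dx.
rewrite lerD ?row_sum_norm1//.
apply: le_trans (row_sum_normM _ _) _.
apply: (@le_trans _ _ (row_sum_norm (x *m a) * row_sum_norm (u k - b) *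
  row_sum_norm (invmx (T a b x)))).
  by rewrite ler_wpM2r ?row_sum_norm_ge0 ?row_sum_normM.
by rewrite mulrAC -/q mulrC -ler_pdivlMr.
Qed.

Lemma invertible_uniform_value (nm : Mn -> R) : matrix_norm nm ->
  matrix_game_has_uniform_value A B nm.
Proof.
move=> /ln_matrix_norm_equiv[c Hc].
have [L G] := invertible_hemimetric_game.
apply: (hemimetric_uniform_value (acts := id) (c := c) G) => // s t k sA tB.
set h := play _ _ _ _ _ => /=.
have [-> uP] : state T 1%:M h = \big[mulmx/1%:M]_(ab <- h) (ab.1 *m ab.2) /\
    \big[mulmx/1%:M]_(ab <- h) (ab.1 *m ab.2) \in unitmx.
  rewrite {}/h; elim: k => [|k [IH uP]] /=; first by rewrite big_nil unitmx1.
  rewrite state_rcons big_mulmx_rcons IH !unitmx_mul uP; split=> //.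
  have Aa := sA (play [::] (fun h a b => rcons h (a, b)) s t k).
  by rewrite uA//= uB//; exact: tB.
rewrite /matrix_payoff /right_dist invmx1 mulmx1; apply: Hc.
apply/eqP => P0; have := unitmx_row_sum_gt0 n_gt0 uP.
rewrite P0 ltNge row_sum_norm_le// => i.
by rewrite big1// => j _; rewrite mxE ComplexField.Normc.normc0.
Qed.

End InvertibleGame.

(** * Multiplication games of matrices preserving the interior of a cone *)

Section PositiveMatrices.
Variables (R : realType) (n : nat) (C : set 'rV[R]_n).
Hypotheses (n_gt0 : (0 < n)%N) (pC : proper_cone C).
Local Notation Mn := 'M[complexField R]_n.
Local Notation normc := ComplexField.Normc.normc.
Implicit Types (x y z e : 'rV[R]_n) (P : 'M[R]_n).

(** This is normality of [C]. For a unit vector [u], one of [u] and [- u] is outside the closed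
    pointed cone together with a ball, so a small multiple of [e] cannot bring both into [C];
    compactness of the sphere makes this uniform. *)
Lemma cone_normal e : C° e -> exists2 c, 0 < c & forall (g : R) y, 0 < g ->
  C (g *: e + y) -> C (g *: e - y) -> `|y| <= c * g.
Proof.
move=> Ce.
have openC v : ~ C v -> exists2 r : R, 0 < r & forall w, `|w| < r -> ~ C (v + w).
  move=> nCv; have oC : open (~` C) by apply: closed_openC; exact: cone_closed pC.
  have /nbhs_normP[r /= r0 Hr] : \near v, (~` C) v by exact: open_nbhs_nbhs.
  exists r => // w wr; apply: Hr.
  by rewrite /ball_/= opprD addrA subrr sub0r normrN.
have /filter_ex[M [M0 HM]] : \forall M \near +oo, 0 < M /\
    forall u : 'rV[R]_n, `|u| = 1 -> ~ (C (M^-1 *: e + u) /\ C (M^-1 *: e - u)).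
  near=> M; split; first by near: M; exact: nbhs_pinfty_gt.
  near: M; apply: (compact_uniform_bound
    (P := fun M u => ~ (C (M^-1 *: e + u) /\ C (M^-1 *: e - u)))
    (@unit_sphere_compact R n)) => u0 /= u01.
  have [v0 nCv0 Hv0] : exists2 v0, ~ C v0 & v0 = u0 \/ v0 = - u0.
    have [Cu|nCu] := pselect (C u0); last by exists u0; [|left].
    exists (- u0); last by right.
    move=> CNu; move: u01; rewrite (cone_pointed pC Cu CNu) normr0 => /esym/eqP.
    by rewrite oner_eq0.
  have [r r0 Hr] := openC _ nCv0.
  near=> u M'; rewrite /=.
  have M0 : 0 < M' by near: M'; exact: nbhs_pinfty_gt.
  have uu0 : `|u0 - u| < r / 2 by near: u; apply: near_dist_lt; rewrite divr_gt0.
  have Mr : `|M'^-1 *: e| < r / 2.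
    rewrite normrZ gtr0_norm ?invr_gt0// ltr_pdivrMl// mulrC -ltr_pdivrMl ?divr_gt0//.
    by near: M'; apply: nbhs_pinfty_gt; rewrite num_real.
  move=> [C1 C2]; case: Hv0 => Ev0.
  - apply: (Hr (M'^-1 *: e + (u - u0))).
      by apply: le_lt_trans (ler_normD _ _) _; rewrite -[`|u - u0|]distrC; lra.
    by rewrite Ev0 addrCA subrKC.
  - apply: (Hr (M'^-1 *: e + (u0 - u))).
      by apply: le_lt_trans (ler_normD _ _) _; lra.
    by rewrite Ev0 addrCA addKr.
exists M => // g y g0 C1 C2; rewrite leNgt; apply/negP => lt_y.
have y0 : 0 < `|y| by apply: lt_trans lt_y; rewrite mulr_gt0.
(* Rescaling by the norm of [y] leaves a coefficient of [e] below [M^-1], because [M * g] is less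
   than that norm; the missing multiple of [e] is added. *)
have small z : C (g *: e + z) -> C (M^-1 *: e + `|y|^-1 *: z).
  move=> Cz; have -> : M^-1 *: e + `|y|^-1 *: z =
      (M^-1 - `|y|^-1 * g) *: e + `|y|^-1 *: (g *: e + z).
    by rewrite scalerDr scalerA addrA -scalerDl subrK.
  apply: (coneD pC); last by apply: (cone_scale pC) => //; rewrite invr_ge0.
  apply: (cone_scale pC); last exact: cone_int.
  by rewrite subr_ge0 ler_pdivrMl// ler_pdivlMr// mulrC ltW.
apply: (HM (`|y|^-1 *: y)); last by split; rewrite -?scalerN; exact: small.
by rewrite normrZ normfV normr_id mulVf// gt_eqF.
Unshelve. all: by end_near. Qed.

(** [z + t *: e] is interior for every [t > 0]; let [t] tend to 0. *)
Lemma preserves_cone P z e : preserves_interior C P -> C° e -> C z -> C (z *m P).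
Proof.
move=> HP Ce Cz; apply: (cone_closure (y := e *m P) pC) => t t0.
rewrite scalemxAl -mulmxDl; apply: cone_int; apply: HP.
by rewrite addrC; apply: cone_intDr => //; exact: cone_intZ.
Qed.

Lemma Funk_mulmx P x y : preserves_interior C P -> C° x -> C° y ->
  Funk C (x *m P) (y *m P) <= Funk C x y.
Proof.
move=> HP Cx Cy; apply/FunkP => //; [exact: HP|exact: HP|].
rewrite scalemxAl -mulmxBl; apply: (preserves_cone HP Cx).
exact: Funk_le.
Qed.

Definition re_mx (M : Mn) : 'M[R]_n := map_mx (@complex.Re R) M.
Definition to_complex_mx (P : 'M[R]_n) : Mn := map_mx (real_complex R) P.

Lemma to_complex_mxK : cancel to_complex_mx re_mx.
Proof. by move=> P; apply/matrixP => i j; rewrite !mxE. Qed.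

Lemma normr_mulmx_re x (M : Mn) :
  `|x *m re_mx M| <= (\sum_k `|x 0 k|) * row_sum_norm M.
Proof.
have le_normc (z : complexField R) : `|complex.Re z| <= normc z.
  by case: z => a b /=; rewrite -sqrtr_sqr ler_sqrt ?addr_ge0 ?sqr_ge0// lerDl sqr_ge0.
rewrite [leLHS]/Num.norm /= mx_normrE; apply: bigmax_le => [|[i j] _ /=].
  by rewrite mulr_ge0 ?row_sum_norm_ge0// sumr_ge0.
rewrite mxE; apply: le_trans (ler_norm_sum _ _ _) _; rewrite mulr_suml.
apply: ler_sum => k _; rewrite ord1 normrM ler_wpM2l// mxE.
by apply: le_trans (le_normc _) _; exact: row_sum_norm_entry.
Qed.

Lemma mulmx_re_continuous x : continuous (fun M => x *m re_mx M).
Proof.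
move=> M; apply/(@cvgrPdist_lt R 'rV[R]_n Mn (nbhs M) (nbhs_filter M)) => t t0.
pose s := \sum_k `|x 0 k|; have s0 : 0 <= s by rewrite sumr_ge0.
have d0 : 0 < t / (s + 1) by rewrite divr_gt0// ltr_wpDl.
near=> P; have HP : row_sum_norm (P - M) <= t / (s + 1).
  by near: P; exact: row_sum_norm_near.
have -> : x *m re_mx M - x *m re_mx P = - (x *m re_mx (P - M)).
  by rewrite -mulmxBr -mulmxN; congr mulmx; apply/matrixP => i j;
    rewrite !mxE /= raddfB opprB.
rewrite normrN; apply: le_lt_trans (normr_mulmx_re _ _) _.
rewrite -/s; apply: (@le_lt_trans _ _ (s * (t / (s + 1)))); first by rewrite ler_wpM2l.
by rewrite mulrCA gtr_pMr// ltr_pdivrMr ?ltr_wpDl// mul1r ltrDl.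
Unshelve. all: by end_near. Qed.

(** The norm controls [Funk] because [e] is interior; [Funk] controls every entry of [P] by
    normality. *)
Lemma Funk_row_sum_norm e : C° e -> exists c, forall P,
  preserves_interior C P ->
  `|ln (row_sum_norm (to_complex_mx P)) - Funk C (e *m P) e| <= c.
Proof.
move=> Ce; have [r r0 Hr] := (cone_interiorP C e).1 Ce.
have [c c0 Hc] := cone_normal Ce.
pose s := \sum_k `|e 0 k|.
have s0 : 0 <= s by rewrite sumr_ge0.
(* Chosen so that [e *m P] divided by [c1] times the norm of [P] is shorter than [r]. *)
pose c1 := 2 * (s + 1) / r; have c10 : 0 < c1.
  by rewrite divr_gt0// mulr_gt0// ltr_wpDl.
pose c2 := n%:R * (2 * c / r); have c20 : 0 < c2.
  by rewrite mulr_gt0 ?ltr0n// divr_gt0// mulr_gt0.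
exists (`|ln c1| + `|ln c2|) => P HP.
have CeP : C° (e *m P) by exact: HP.
pose M := to_complex_mx P.
have M0 : 0 < row_sum_norm M.
  apply: row_sum_norm_gt0; apply: contra_neq (cone_int_neq0 n_gt0 pC CeP) => M0.
  rewrite -(to_complex_mxK P) -/M M0; apply/rowP => j; rewrite !mxE big1// => k _.
  by rewrite !mxE mulr0.
have up : Funk C (e *m P) e <= ln c1 + ln (row_sum_norm M).
  apply/FunkP => //; rewrite expRD !lnK ?posrE//.
  set t := c1 * _; have t0 : 0 < t by rewrite mulr_gt0.
  have -> : t *: e - e *m P = t *: (e - t^-1 *: (e *m P)).
    by rewrite scalerBr scalerA divff ?scale1r// gt_eqF.
  apply: (cone_scale pC (ltW t0)); apply: Hr.
  rewrite normrN normrZ gtr0_norm ?invr_gt0// ltr_pdivrMl//.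
  rewrite -(to_complex_mxK P) -/M; apply: le_lt_trans (normr_mulmx_re _ _) _.
  rewrite -/s /t mulrAC ltr_pM2r// /c1 divfK ?gt_eqF//; lra.
pose g := expR (Funk C (e *m P) e).
have g0 : 0 < g by exact: expR_gt0.
have lo : ln (row_sum_norm M) <= ln c2 + Funk C (e *m P) e.
  rewrite -[Funk _ _ _]expRK -lnM ?posrE// ler_ln ?posrE//;
    last exact: mulr_gt0.
  rewrite -/g /c2 -[leRHS]mulrA; apply: row_sum_norm_entries => [|i j].
    by rewrite mulr_ge0 ?divr_ge0 ?mulr_ge0// ltW.
  rewrite mxE /= expr0n addr0 sqrtr_sqr.
  (* Both [e + w] and [e - w] lie in [C], so [w *m P], a multiple of row [i] of [P], lies between
     [- g *: e] and [g *: e] for the cone order. *)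
  pose w : 'rV[R]_n := (r / 2) *: delta_mx 0 i.
  have w_small : `|w| < r.
    apply: (@le_lt_trans _ _ (r / 2)); last lra.
    rewrite [leLHS]/Num.norm /= mx_normrE; apply: bigmax_le => [|[k l] _ /=].
      by rewrite divr_ge0// ltW.
    rewrite !mxE; case: (_ && _); rewrite ?mulr1 ?mulr0 ?normr0 ?divr_ge0 ?(ltW r0)//.
    by rewrite gtr0_norm// divr_gt0.
  have Cw v : C (e + v) -> C (g *: e + v *m P).
    move=> /(preserves_cone HP Ce); rewrite mulmxDl => Cev.
    rewrite -(subrK (e *m P) (g *: e)) -addrA; apply: (coneD pC) => //.
    exact: Funk_le.
  have : `|w *m P| <= c * g.
    apply: Hc => //; rewrite -?mulNmx; apply: Cw; apply: Hr => //.
    by rewrite normrN.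
  have wP : (w *m P) 0 j = r / 2 * P i j by rewrite /w -scalemxAl -rowE !mxE.
  have := mx_norm_ge_entry (w *m P) 0 j; rewrite wP normrM gtr0_norm ?divr_gt0// => H1 H2.
  have -> : 2 * c / r * g = (r / 2)^-1 * (c * g) by rewrite invf_div; lra.
  by rewrite ler_pdivlMl ?divr_gt0//; exact: le_trans H2.
have := ler_norm (ln c2); have := ler_norm (ln c1).
have := normr_ge0 (ln c2); have := normr_ge0 (ln c1).
by rewrite -/M => *; rewrite ler_norml; apply/andP; split; lra.
Qed.

Variables (A B : set Mn).
Hypotheses (A0 : A !=set0) (cA : compact A) (B0 : B !=set0) (cB : compact B).
Hypothesis pA : forall M, A M -> exists P, M = to_complex_mx P /\ preserves_interior C P.
Hypothesis pB : forall M, B M -> exists P, M = to_complex_mx P /\ preserves_interior C P.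

Let T (a b : Mn) x := x *m re_mx a *m re_mx b.

Let reA a : A a -> preserves_interior C (re_mx a).
Proof. by move=> /pA[P [->]]; rewrite to_complex_mxK. Qed.

Let reB b : B b -> preserves_interior C (re_mx b).
Proof. by move=> /pB[P [->]]; rewrite to_complex_mxK. Qed.

(** The matrices [a] and [b] act nonexpansively one after the other, so their displacements of [e]
    add up to at most [tA + tB]. *)
Lemma positive_hemimetric_game e : C° e -> exists L,
  hemimetric_game C° (Funk C) A B T e L.
Proof.
move=> Ce; have dominated (K : set Mn) : compact K ->
    (forall M, K M -> preserves_interior C (re_mx M)) -> exists t, forall M, K M ->
      Funk C e (e *m re_mx M) <= t /\ Funk C (e *m re_mx M) e <= t.
  move=> cK KP.
  have [| |t Ht] := compact_cone_dominated n_gt0 pC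
      (K := (fun M => e *m re_mx M) @` K) _ _ Ce.
  - apply: continuous_compact => //; apply: continuous_subspaceT.
    exact: mulmx_re_continuous.
  - by move=> _ [M KM <-]; exact: KP.
  by exists t => M KM; apply: Ht; exists M.
have [tA HA] := dominated _ cA reA; have [tB HB] := dominated _ cB reB.
exists (tA + tB); split=> //.
- by move=> a b x Aa Bb Cx; apply: reB => //; exact: reA.
- by move=> *; exact: Funk_triangle.
- move=> a b x y Aa Bb Cx Cy; apply: le_trans (Funk_mulmx (reA Aa) Cx Cy).
  by apply: Funk_mulmx; [exact: reB|exact: reA|exact: reA].
- move=> a b Aa Bb; have Ca := reA Aa Ce; have Cb := reB Bb Ce.
  have Cab := reB Bb Ca.
  apply: le_trans (Funk_triangle n_gt0 pC Cab Cb Ce) _.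
  rewrite lerD ?(HB _ Bb).2//; apply: le_trans (HA _ Aa).2.
  exact: Funk_mulmx (reB Bb) Ca Ce.
- move=> a b Aa Bb; have Ca := reA Aa Ce; have Cb := reB Bb Ce.
  have Cab := reB Bb Ca.
  apply: le_trans (Funk_triangle n_gt0 pC Ce Cb Cab) _.
  rewrite addrC lerD ?(HB _ Bb).1//; apply: le_trans (HA _ Aa).1.
  exact: Funk_mulmx (reB Bb) Ce Ca.
- move=> U u a x UU Bu Aa Cx.
  apply: (Funk_ultra n_gt0 pC cB (f := fun b => T a b x)) => // [|b Bb].
    by apply: continuous_subspaceT; exact: mulmx_re_continuous.
  by apply: reB => //; exact: reA.
Qed.

Lemma positive_uniform_value (nm : Mn -> R) : matrix_norm nm ->
  matrix_game_has_uniform_value A B nm.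
Proof.
move=> /ln_matrix_norm_equiv[c Hc]; have [e Ce] := cone_interior pC.
have [L G] := positive_hemimetric_game Ce.
have [c' Hc'] := Funk_row_sum_norm Ce.
apply: (hemimetric_uniform_value (acts := id) (c := c + c') G) => // s t k sA tB.
set h := play _ _ _ _ _ => /=.
(* The whole product is a real matrix preserving the interior, so [Funk_row_sum_norm] applies to it
   at once and the error does not accumulate over turns. *)
have [P [HP hP ->]] : exists P, [/\ preserves_interior C P,
    \big[mulmx/1%:M]_(ab <- h) (ab.1 *m ab.2) = to_complex_mx P &
    state T e h = e *m P].
  rewrite {}/h; elim: k => [|k [P [HP hP sP]]] /=.
    exists 1%:M; split; first by move=> x Cx; rewrite mulmx1.
      by rewrite big_nil /to_complex_mx map_mx1.
    by rewrite mulmx1.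
  set h := play _ _ _ _ k in hP sP *.
  have [Pa [Ea HPa]] := pA (sA h); have [Pb [Eb HPb]] := pB (tB h _ (sA h)).
  exists (P *m Pa *m Pb); split.
  - by move=> x Cx; rewrite !mulmxA; apply: HPb; apply: HPa; exact: HP.
  - by rewrite big_mulmx_rcons hP {1}Eb {1}Ea /to_complex_mx !map_mxM.
  - by rewrite state_rcons sP /T Eb Ea !to_complex_mxK !mulmxA.
rewrite /matrix_payoff hP.
have M0 : to_complex_mx P != 0.
  apply: contra_neq (cone_int_neq0 n_gt0 pC (HP _ Ce)) => M0.
  rewrite -(to_complex_mxK P) M0; apply/rowP => j; rewrite !mxE big1// => i _.
  by rewrite !mxE mulr0.
apply: le_trans (ler_distD (ln (row_sum_norm (to_complex_mx P))) _ _) _.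
by rewrite lerD ?Hc ?Hc'.
Qed.

End PositiveMatrices.

Theorem corollary20 (R : realType) (n : nat) (n_gt0 : (0 < n)%N) :
  (forall (TA TB : topologicalType) (C : set 'rV[R]_n)
          (A : set TA) (B : set TB) (T : TA -> TB -> 'rV[R]_n -> 'rV[R]_n)
          (x0 : 'rV[R]_n),
      conical_escape_rate_game C A B T -> C° x0 ->
      escape_game_has_uniform_value C A B T x0)
  /\
  (forall (A B : set 'M[complexField R]_n) (nm : 'M[complexField R]_n -> R),
      A !=set0 -> compact A -> B !=set0 -> compact B -> matrix_norm nm ->
      (A `|` B `<=` [set M | M \in unitmx])
      \/
      (exists C : set 'rV[R]_n, proper_cone C /\
        forall M, (A `|` B) M ->
        exists M' : 'M[R]_n, M = map_mx (real_complex R) M' /\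
          preserves_interior C M') ->
      matrix_game_has_uniform_value A B nm).
Proof.
split=> [TA TB C A B T x0|A B nm A0 cA B0 cB nmP]; first exact: escape_uniform_value.
case=> [uAB|[C [pC HC]]].
  by apply: invertible_uniform_value => // M HM; apply: uAB; [left|right].
by apply: (positive_uniform_value n_gt0 pC) => // M HM; apply: HC; [left|right].
Qed.
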